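(* Let $P, Q$ be $\mathbb{L}$-polytopes in $V$ with identical universal counting function, i.e. $|P\cap \mathbb{L}'| = |Q\cap \mathbb{L}'|$ for every lattice $\mathbb{L}'$ in $V$ of rank $n$ with $\mathbb{L}\subseteq \mathbb{L}'$. Then, for every primitive $z\in \mathbb{L}^*$, $$\operatorname{rvol} P(z)+\operatorname{rvol} P(-z)=\operatorname{rvol} Q(z)+\operatorname{rvol} Q(-z).$$
   Context: $V$ is a real vector space of finite dimension $n\ge 1$ and $\mathbb{L}\subset V$ is a lattice of rank $n$ (the $\mathbb{Z}$-span of a basis of $V$). An $\mathbb{L}$-polytope is the convex hull of a nonempty finite set of points of $\mathbb{L}$. For a finite set $A$, $|A|$ is its cardinality. The universal counting function of an $\mathbb{L}$-polytope $P$ is the function $\mathcal{U}_P$ assigning to each rank-$n$ lattice $\mathbb{L}'\supseteq \mathbb{L}$ in $V$ the number $\mathcal{U}_P(\mathbb{L}')=|P\cap \mathbb{L}'|$. $\mathbb{L}^*$ is the dual lattice, i.e. the set of linear functionals on $V$ taking integer values on $\mathbb{L}$; $z\in\mathbb{L}^*$ is primitive if $z\neq 0$ and $z$ is not of the form $mz'$ with $z'\in\mathbb{L}^*$ and an integer $m\ge 2$. For nonzero $z\in \mathbb{L}^*$, $P(z)$ denotes the face of $P$ consisting of the points of $P$ at which the functional $z$ attains its maximum over $P$. Relative volume: if $F$ is an $(n-1)$-dimensional face of an $\mathbb{L}$-polytope with affine hull $H$, then $\operatorname{rvol}(F)=\operatorname{Vol}_{n-1}(F)/\operatorname{Vol}_{n-1}(D)$,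 where $D$ is a fundamental parallelotope of the $(n-1)$-dimensional lattice $H\cap\mathbb{L}$ (regarded as a lattice after translating a point of $H\cap \mathbb{L}$ to the origin), and $\operatorname{Vol}_{n-1}$ is any fixed $(n-1)$-dimensional Lebesgue measure on $H$ (for $n=1$ a single point has $\operatorname{rvol}=1$). If $F$ is a face of dimension at most $n-2$, then $\operatorname{rvol}(F)=0$. *)

(* Defs.v *)
From HB Require Import structures.
From mathcomp Require Import all_boot all_order all_algebra finmap.
From mathcomp Require Import all_classical all_reals all_analysis.

Set Implicit Arguments.
Unset Strict Implicit.
Unset Printing Implicit Defensive.

Import Order.TTheory GRing.Theory Num.Theory.

Local Open Scope classical_set_scope.
Local Open Scope ring_scope.

Section LebesgueTuple.
Variable R : realType.
Local Notation TR := (measurableTypeR R).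

Definition tuple_cons m (p : TR * m.-tuple TR) : m.+1.-tuple TR :=
  [tuple of p.1 :: p.2].

Lemma measurable_tuple_cons m : measurable_fun [set: _] (@tuple_cons m).
Proof. exact: measurable_cons. Qed.

Section step.
Variables (m : nat) (mu : {sigma_finite_measure set (m.-tuple TR) -> \bar R}).

Definition lebesgue_cons : set (m.+1.-tuple TR) -> \bar R :=
  pushforward (lebesgue_measure \x mu)%E (@tuple_cons m).

Let cons_0 : lebesgue_cons set0 = 0%E.
Proof. by apply: measure0; exact: measurable_tuple_cons. Qed.

Let cons_ge0 A : (0 <= lebesgue_cons A)%E.
Proof. by apply: measure_ge0; exact: measurable_tuple_cons. Qed.

Let cons_sigma_additive : semi_sigma_additive lebesgue_cons.
Proof. by apply: measure_semi_sigma_additive; exact: measurable_tuple_cons. Qed.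

HB.instance Definition _ := isMeasure.Build _ _ _ lebesgue_cons
  cons_0 cons_ge0 cons_sigma_additive.

Let cons_sigma_finite : sigma_finite [set: m.+1.-tuple TR] lebesgue_cons.
Proof.
have /sigma_finiteP[F [FT ndF Ffin]] := sigma_finiteT (@lebesgue_measure R).
have /sigma_finiteP[G [GT ndG Gfin]] := sigma_finiteT mu.
pose u (t : m.+1.-tuple TR) : TR * m.-tuple TR :=
  (tnth t ord0, [tuple of behead t]).
have consK : cancel (@tuple_cons m) u.
  by case=> x t; congr pair; apply/val_inj.
have mu_meas : measurable_fun [set: m.+1.-tuple TR] u.
  apply/measurable_fun_pair; first exact: measurable_tnth.
  exact: measurable_behead.
exists (fun i => u @^-1` (F i `*` G i)).
  rewrite -preimage_bigcup -[LHS](preimage_setT u); congr (u @^-1` _).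
  rewrite -setXTT FT GT predeqE => -[x y]; split.
    move=> [/= [i _ Fix] [k _ Gky]]; exists (maxn i k) => //; split.
    - by move: x Fix; exact/subsetPset/ndF/leq_maxl.
    - by move: y Gky; exact/subsetPset/ndG/leq_maxr.
  by move=> [i _ []/= ? ?]; split; exists i.
move=> i; have [mF Fi] := Ffin i; have [mG Gi] := Gfin i.
split; first by rewrite -[_ @^-1` _]setTI; apply: mu_meas => //; exact: measurableX.
rewrite /lebesgue_cons /pushforward -comp_preimage (_ : u \o _ = id); last first.
  by apply/funext => p; exact: consK.
by rewrite preimage_id product_measure1E// lte_mul_pinfty// ge0_fin_numE.
Qed.

HB.instance Definition _ := Measure_isSigmaFinite.Build _ _ _ lebesgue_cons
  cons_sigma_finite.

End step.

(* Lebesgue measure on R^m, as the m-fold product of [lebesgue_measure]; on the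
   one-point space R^0 it is the unit mass. *)
Fixpoint lebesgue_tuple (m : nat) :
    {sigma_finite_measure set (m.-tuple TR) -> \bar R} :=
  match m with
  | 0 => @dirac _ (0.-tuple TR) [tuple] R
  | m'.+1 => lebesgue_cons (lebesgue_tuple m')
  end.

End LebesgueTuple.

Section Lattice.
Variables (R : realType) (V : vectType R).
Implicit Types (L A S : set V) (U : {vspace V}) (z : 'Hom(V, R^o)).

Definition lattice_basis U (b : (\dim U).-tuple V) A : Prop :=
  basis_of U b /\ A = [set v | inIntSpan b v].

Definition lattice L : Prop :=
  exists b : (\dim {:V}).-tuple V, lattice_basis b L.

Definition conv_hull S : set V := smallest (@convex_set R V) S.

Definition lattice_polytope L (P : set V) : Prop :=
  exists S, [/\ finite_set S, S !=set0, S `<=` L & P = conv_hull S].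

(* The universal counting function of [P], to be evaluated at the lattices
   containing the given one; [P `&` L'] is then finite, so the default value
   [fset0] of [fset_set] on infinite sets is irrelevant. *)
Definition universal_count (P L' : set V) : nat := #|` fset_set (P `&` L')|.

Definition dual_lattice L : set 'Hom(V, R^o) :=
  [set z | forall x, L x -> (z x : R) \is a Num.int].

Definition primitive L z : Prop :=
  [/\ dual_lattice L z, z != 0 &
      ~ exists z' (m : int), [/\ dual_lattice L z', 2 <= m & z = z' *~ m]].

Definition face (P : set V) z : set V :=
  [set x | P x /\ forall y, P y -> (z y : R) <= z x].

Definition affine_subspace (p : V) U : set V := [set x | x - p \in U].

Definition is_affine A : Prop := exists p U, A = affine_subspace p U.

Definition affine_hull S : set V := smallest is_affine S.

Definition affine_coord m (p : V) (e : m.-tuple V)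
    (t : m.-tuple (measurableTypeR R)) : V :=
  p + \sum_(i < m) (tnth t i : R) *: tnth e i.

(* The Lebesgue measure on [p + U] for which the parallelotope spanned by the
   basis [e] of [U] has measure 1; every Lebesgue measure on an affine subspace
   is of this form for some [e]. *)
Definition affine_lebesgue m (p : V) (e : m.-tuple V) A : \bar R :=
  lebesgue_tuple R m (affine_coord p e @^-1` A).

Definition parallelotope m (p : V) (b : m.-tuple V) : set V :=
  [set x | exists2 c : 'I_m -> R, (forall i, 0 <= c i < 1) &
           x = p + \sum_(i < m) c i *: tnth b i].

(* [r] is a value of the relative volume of [F], computed with some base point
   [p] of [H `&` L], where [H] is the affine hull of [F], some basis [b] of the
   translated lattice and some Lebesgue measure on [H] (given by [e]). Holds
   for no [r] unless [F] has dimension n - 1. *)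
Definition is_rvol L (F : set V) (r : R) : Prop :=
  exists (p : V) (U : {vspace V}) (b e : (\dim U).-tuple V),
    let H := affine_hull F in
    [/\ (\dim U).+1 = \dim {:V}, H = affine_subspace p U, L p &
    [/\ lattice_basis b [set x - p | x in H `&` L], basis_of U e &
        r = fine (affine_lebesgue p e F)
            / fine (affine_lebesgue p e (parallelotope p b))]].

(* The value does not depend on the choices in [is_rvol]; the default value 0
   is the relative volume of the faces of dimension at most n - 2. *)
Definition rvol L (F : set V) : R := xget 0 [set r | is_rvol L F r].

End Lattice.

(* Main.v *)
From HB Require Import structures.
Require Import Defs.
From mathcomp Require Import all_boot all_order all_algebra finmap.
From mathcomp Require Import all_classical all_reals all_analysis measurable_realfun.
From mathcomp Require Import zify ring lra.

(* For a primitive [z], choose a basis [w, e_1, .., e_d] of [L] with [z w = 1]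
   and [e_1, .., e_d] a basis of the lattice of the kernel of [z].  Count the
   points of [P] in the refined lattices spanned by the [e_i / k] and [w / m],
   with [k = 2 ^ K] and [m = 2 ^ p], layer by layer: if [f t] is the normalized
   number of points of [P] at height [t], the count for [m] is the sum [S m] of
   [f] over the multiples of [1 / m].  Then [2 * S m - S (2 * m)] is half the sum
   of the values of [f] at the two extreme heights, up to a sum of second
   differences of [f].  As the vertices of [P] have integer heights, [f] is
   Lipschitz at scale [1 / k] up to the extreme heights, so that the energies
   [m * sum (f (t + 1 / m) - f t) ^ 2] are bounded; they increase with [p], and
   their increments dominate the squares of the error terms.  By the pigeonhole
   principle some [p < K] gives an error [O(1 / sqrt K)], for [P] and [Q] at
   once.  Finally [f] at an extreme height, which counts lattice points of a
   face, tends to the relative volume of that face. *)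

Set Implicit Arguments.
Unset Strict Implicit.
Unset Printing Implicit Defensive.

Import Order.TTheory GRing.Theory Num.Theory.
Local Open Scope ring_scope.

(** * Counting grid points of convex sets *)

Section GridCount.
Variable R : realType.

(** For a smooth [f], the sum [S m] would be [m] times the integral of [f], plus half the sum of its
    extreme values, plus an error tending to 0. The combination [2 * S m - S (2 * m)] is formed
    because it cancels the integral, that is, the unknown volume. The obstacle is that [f] counts
    points and jumps at scale [1 / k]: its second differences have no better termwise bound than its
    first ones, so no scale prescribed in advance is known to be good. Only their total over all
    scales is controlled, which is why a whole range of [p] is needed. Scales finer than the mesh
    [1 / k] are excluded because the rounding in the counts would spoil the Lipschitz bound there.
    The counts of [P] and [Q] can be compared only at equal [m], so the good scale is sought for the
    sum of their energies; their ranges of heights are never compared. With [k = 2 ^ K], replacing a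
    face count by a relative volume costs [O(1 / k)], far less than [1 / sqrt K]. *)

Definition is_convex (E : lmodType R) (A : set E) :=
  forall x y (s : R), A x -> A y -> 0 <= s <= 1 -> A (s *: x + (1 - s) *: y).

(** If [s < dl], then [y] lies between the points [x + s e] and [y + t e] of [A], and convexity puts
    it in [A]. Hence points of a line that are outside [A], but reach it by a step of at most [eps]
    in one common direction, are at most [eps] apart. *)
Lemma convex_exit (E : lmodType R) (A : set E) (x y e : E) (s t dl : R) :
  is_convex A -> y = x + dl *: e -> A (x + s *: e) -> A (y + t *: e) ->
  ~ A y -> 0 < t -> dl <= s.
Proof.
move=> cA -> Ax Ay nAy t0; rewrite leNgt; apply/negP => sd; apply: nAy.
have h : 0 < dl - s + t by lra.
pose c := t / (dl - s + t); pose c' : R := 1 - c.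
have c01 : 0 <= c <= 1.
  apply/andP; split; first by apply: divr_ge0; lra.
  by rewrite ler_pdivrMr//; lra.
suff -> : x + dl *: e = c *: (x + s *: e) + c' *: (x + dl *: e + t *: e) by exact: cA.
have {1}-> : dl = c * s + c' * (dl + t) by rewrite /c' /c; field; lra.
have {1}-> : x = c *: x + c' *: x by rewrite -scalerDl subrKC scale1r.
clearbody c'; rewrite mulrDr !scalerDl !scalerDr !scalerA -!addrA.
by congr (_ + _); rewrite addrCA.
Qed.

Lemma card_ord_spread n (T : {set 'I_n}) (c : R) : 0 <= c ->
  (forall p q, p \in T -> q \in T -> (p < q)%N -> (q - p)%N%:R <= c) ->
  #|T|%:R <= c + 1.
Proof.
move=> c0 h; have [->|[p0 p0T]] := set_0Vmem T.
  by rewrite cards0; lra.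
pose p := [arg min_(i < p0 in T) (i : nat)].
pose q := [arg max_(i > p0 in T) (i : nat)].
have [pT pmin] : p \in T /\ forall j, j \in T -> (p <= j)%N.
  by rewrite /p; case: arg_minnP.
have [qT qmax] : q \in T /\ forall j, j \in T -> (j <= q)%N.
  by rewrite /q; case: arg_maxnP.
have qpc : (q - p)%N%:R <= c.
  have [pq|qp] := ltnP p q; first exact: h.
  by move: qp; rewrite -subn_eq0 => /eqP->.
have cT : (#|T| <= (q - p).+1)%N.
  rewrite -[X in (_ <= X)%N]card_ord.
  pose g (x : 'I_n) : 'I_(q - p).+1 := inord (x - p).
  rewrite -(card_in_imset (f := g)); first exact: max_card.
  move=> x y xT yT /(congr1 val); rewrite /= !inordK.
  - by move=> e; apply/val_inj => /=; have := pmin _ xT; have := pmin _ yT; lia.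
  - by have := pmin _ yT; have := qmax _ yT; lia.
  - by have := pmin _ xT; have := qmax _ xT; lia.
by apply: le_trans (_ : (q - p).+1%:R <= _); rewrite ?ler_nat// -natr1 lerD2r.
Qed.

(* The points of [(1 / k) Z ^ d] in the window [-M, M] ^ d; [o] encodes [o / k - M]. *)
Definition gridpt d M k (o : {ffun 'I_d -> 'I_(2 * M * k).+1}) : 'rV[R]_d :=
  \row_i ((o i)%:R / k%:R - M%:R).

Definition gcount d M k (K : set 'rV[R]_d) : nat :=
  #|[set o : {ffun 'I_d -> 'I_(2 * M * k).+1} | `[< K (gridpt o) >]]|.

(** Each line parallel to axis [i] is represented by its point of [i]-th index 0; there are
    [B.+1 ^ d.-1] of these. *)
Lemma card_fibers d B (X : {set {ffun 'I_d -> 'I_B.+1}}) (i : 'I_d) (c : R) :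
  (forall y : {ffun 'I_d -> 'I_B.+1},
     #|[set o in X | [forall j, (j != i) ==> (o j == y j)]]|%:R <= c) ->
  #|X|%:R <= (B.+1 ^ d.-1)%N%:R * c.
Proof.
move=> h.
pose g (o : {ffun 'I_d -> 'I_B.+1}) := [ffun j => if j == i then ord0 else o j].
pose Y := [set o : {ffun 'I_d -> 'I_B.+1} | o i == ord0].
have cY : #|Y| = (B.+1 ^ d.-1)%N.
  rewrite -[d in RHS]card_ord -(cardC1 i) -[B.+1 in RHS]card_ord.
  rewrite -(card_pffun_on ord0 (predC1 i) (mem 'I_B.+1)).
  apply: eq_card => o; rewrite /Y !finset.inE; apply/idP/idP.
    move=> /eqP oi; apply/pffun_onP; split => //.
    by apply/fintype.subsetP => j; rewrite !finset.inE; apply: contra => /eqP->;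
      rewrite oi.
  move=> /pffun_onP[/fintype.subsetP s _]; apply/negPn/negP => oi.
  by have := s i; rewrite !finset.inE eqxx => /(_ oi).
rewrite -cY -sum1_card (partition_big g (mem Y))/=; last first.
  by move=> o _; rewrite /Y !finset.inE ffunE eqxx.
rewrite natr_sum -sum1_card natr_sum mulr_suml; apply: ler_sum => y yY.
rewrite mul1r sum1dep_card; apply: le_trans (h y); rewrite ler_nat.
apply: subset_leq_card; apply/fintype.subsetP => o;
  rewrite !finset.inE => /andP[-> /eqP <-]/=.
by apply/forallP => j; apply/implyP => ji; rewrite ffunE (negPf ji).
Qed.

(** On a line parallel to axis [i], the points of [K'] outside [K] lie within [eps] of [K] on one of
    its two sides. By [convex_exit] those of one side span at most [eps], which leaves room for
    [eps * k + 1] grid points. *)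
Lemma gcount_thicken1 d M k (i : 'I_d) (K K' : set 'rV[R]_d) (eps : R) :
  (0 < k)%N -> 0 <= eps -> is_convex K ->
  (forall x, K' x -> exists2 s, `|s| <= eps & K (x + s *: delta_mx 0 i)) ->
  (gcount M k K')%:R <=
    (gcount M k K)%:R + ((2 * M * k).+1 ^ d.-1)%N%:R * (2 * (eps * k%:R + 1)) :> R.
Proof.
move=> k0 eps0 cK KK'; rewrite /gcount.
set A' := [set o | `[< K' _ >]]; set A := [set o | `[< K _ >]].
apply: le_trans (_ : #|A|%:R + #|A' :\: A|%:R <= _).
  rewrite -natrD ler_nat -(cardsID A A') leq_add2r subset_leq_card//.
  exact: subsetIr.
rewrite lerD2l; apply: (card_fibers (i := i)) => y.
set F := [set o in _ | _].
have [k0' kn0] : 0 < k%:R :> R /\ k%:R != 0 :> R.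
  by rewrite ltr0n k0 pnatr_eq0 -lt0n k0.
have gridF o o' : o \in F -> o' \in F ->
    gridpt o' = gridpt o + (((o' i)%:R - (o i)%:R) / k%:R) *: delta_mx 0 i.
  rewrite !finset.inE => /andP[_ /forallP ho] /andP[_ /forallP ho'].
  apply/rowP => j; rewrite !mxE eqxx/=.
  have [->|ji] := eqVneq j i; first by rewrite mulr1; ring.
  by move: (ho j) (ho' j); rewrite ji => /= /eqP-> /eqP->; rewrite mulr0 addr0.
pose side (sg : R) := [set o in F | `[< exists2 s,
  0 < s <= eps & K (gridpt o + (sg * s) *: delta_mx 0 i) >]].
have FU : F \subset side 1 :|: side (-1).
  apply/fintype.subsetP => o oF; rewrite !finset.inE -/F; move: (oF);
    rewrite !finset.inE => -> /=.
  move: oF; rewrite !finset.inE => /andP[/andP[/asboolP nK /asboolP/KK'[s se Ks]] _].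
  have [s0|s0|s0] := ltgtP s 0.
  - apply/orP; right; apply/asboolP; exists (- s); last by rewrite mulrN mulN1r opprK.
    by rewrite oppr_gt0 s0 -ltr0_norm.
  - apply/orP; left; apply/asboolP; exists s; last by rewrite mul1r.
    by rewrite s0 -(gtr0_norm s0).
  - by move: Ks; rewrite s0 scale0r addr0.
have ctsd sg : (sg = 1 \/ sg = -1) -> #|side sg|%:R <= eps * k%:R + 1 :> R.
  move=> sgE.
  pose g (o : {ffun 'I_d -> 'I_(2 * M * k).+1}) := o i.
  rewrite -(card_in_imset (f := g)); last first.
    move=> o o'; rewrite !(finset.inE) =>
      /andP[/andP[_ /forallP ho] _] /andP[/andP[_ /forallP ho'] _] e.
    apply/ffunP => j; have [->//|ji] := eqVneq j i.
    by move: (ho j) (ho' j); rewrite ji => /= /eqP-> /eqP->.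
  apply: card_ord_spread; first by rewrite mulr_ge0// ltW.
  move=> _ _ /imsetP[ o oS ->] /imsetP[ o' o'S ->] oo'.
  rewrite natrB; last exact: ltnW.
  rewrite -ler_pdivrMr//.
  have [oF o'F] : o \in F /\ o' \in F.
    by move: oS o'S; rewrite [_ \in side _]finset.inE => /andP[-> _];
      rewrite [_ \in side _]finset.inE => /andP[-> _].
  have [[s /andP[s0 se] Ks] nK] : (exists2 s,
    0 < s <= eps & K (gridpt o + (sg * s) *: delta_mx 0 i)) /\ ~ K (gridpt o).
    by move: oS; rewrite !finset.inE => /andP[/andP[/andP[/asboolP ? _] _] /asboolP].
  have [[s' /andP[s0' se'] Ks'] nK'] : (exists2 s,
    0 < s <= eps & K (gridpt o' + (sg * s) *: delta_mx 0 i)) /\ ~ K (gridpt o').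
    by move: o'S; rewrite !finset.inE => /andP[/andP[/andP[/asboolP ? _] _] /asboolP].
  have := gridF _ _ oF o'F; set dl := (_ / _) => go'.
  case: sgE => sgE; rewrite sgE in Ks Ks'.
    move: Ks Ks'; rewrite !mul1r => Ks Ks'.
    exact: le_trans (convex_exit cK go' Ks Ks' nK' s0') se.
  move: Ks Ks'; rewrite !mulN1r !scaleNr -!scalerN => Ks Ks'.
  (* In the negative direction the points [o] and [o'] exchange roles. *)
  apply: le_trans (convex_exit (dl := dl) cK _ Ks' Ks nK s0) se'.
  by rewrite go' scalerN addrK.
apply: le_trans (_ : (#|side 1%R| + #|side (-1)%R|)%N%:R <= _).
  by rewrite ler_nat (leq_trans (subset_leq_card FU))// cardsU leq_subr.
by rewrite natrD; have := ctsd 1 (or_introl erefl);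
  have := ctsd (-1) (or_intror erefl); lra.
Qed.

(** One coordinate is thickened at a time: [T n] is [K] plus the box of half-side [eps] in the first
    [n] coordinates. It stays convex, so [gcount_thicken1] applies [d] times, and [T d] contains
    [K']. *)
Lemma gcount_thicken d M k (K K' : set 'rV[R]_d) (eps : R) :
  (0 < k)%N -> 0 <= eps -> is_convex K ->
  (forall x, K' x -> exists2 u : 'rV_d, (forall i, `|u 0 i| <= eps) & K (x + u)) ->
  (gcount M k K')%:R <=
    (gcount M k K)%:R + d%:R * (((2 * M * k).+1 ^ d.-1)%N%:R * (2 * (eps * k%:R + 1)))
      :> R.
Proof.
move=> k0 eps0 cK KK'.
pose T n : set 'rV[R]_d := fun x => exists2 u : 'rV[R]_d,
  (forall i : 'I_d, `|u 0 i| <= eps /\ ((n <= i)%N -> u 0 i = 0)) & K (x + u).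
have cT n : is_convex (T n).
  move=> x y s [u hu Ku] [v hv Kv] s01; exists (s *: u + (1 - s) *: v).
    move=> i; rewrite !mxE; split.
      have [hui _] := hu i; have [hvi _] := hv i.
      rewrite (le_trans (ler_normD _ _))// !normrM (@ger0_norm _ s) ?(@ger0_norm _
        (1-s)); try lra.
      by nra.
    by move=> ni; rewrite (hu i).2// (hv i).2// !mulr0 addr0.
  by rewrite addrACA -!scalerDr; apply: cK.
have step n : (n <= d)%N -> (gcount M k (T n))%:R <=
    (gcount M k K)%:R + n%:R * (((2 * M * k).+1 ^ d.-1)%N%:R * (2 * (eps * k%:R + 1)))
      :> R.
  elim: n => [_|n IH nd].
    rewrite mul0r addr0 ler_nat; apply: subset_leq_card.
    apply/fintype.subsetP => o; rewrite !finset.inE => /asboolP[u hu Ku]; apply/asboolP.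
    suff -> : gridpt o = gridpt o + u by [].
    suff -> : u = 0 by rewrite addr0.
    by apply/rowP => i; rewrite (hu i).2// mxE.
  rewrite -natr1 mulrDl mul1r addrA.
  apply: le_trans (lerD (IH (ltnW nd)) (lexx _)).
  apply: (@gcount_thicken1 _ _ _ (Ordinal nd)) => // x [u hu Ku].
  exists (u 0 (Ordinal nd)); first by have [] := hu (Ordinal nd).
  exists (u - u 0 (Ordinal nd) *: delta_mx 0 (Ordinal nd)).
    move=> i; rewrite !mxE eqxx/=; have [->|ni] := eqVneq i (Ordinal nd).
      by rewrite mulr1 subrr normr0.
    rewrite mulr0 subr0; split; first by have [] := hu i.
    move=> le_ni; apply: (hu i).2; rewrite ltn_neqAle le_ni andbT.
    by apply: contra ni => /eqP e; apply/eqP/val_inj.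
  by rewrite addrACA subrr addr0.
apply: le_trans (step d (leqnn d)).
rewrite ler_nat; apply: subset_leq_card.
apply/fintype.subsetP => o; rewrite !finset.inE => /asboolP/KK'[u hu Ku]; apply/asboolP.
by exists u => // i; split => //; rewrite leqNgt ltn_ord.
Qed.

End GridCount.

(** * The trapezoidal rule along the dyadic scale *)

Section DyadicEnergy.
Variable R : realType.
Implicit Types (f g : R -> R) (a b : R).

Lemma sqr_sum_le n (x : 'I_n -> R) :
  (\sum_i x i) ^+ 2 <= n%:R * \sum_i x i ^+ 2.
Proof.
elim: n x => [|n IH] x; first by rewrite !big_ord0 mul0r expr0n.
rewrite !big_ord_recr /= -natr1.
move: (IH (fun i => x (widen_ord (leqnSn n) i))).
set s := \sum_(i < n) _; set q := \sum_(i < n) _; set y := x _ => h.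
have [n0|n0] := posnP n.
  have -> : s = 0 by rewrite /s; move: x @s @q @y h; rewrite n0 => x *;
    rewrite big_ord0.
  have -> : q = 0 by rewrite /q; move: x @s @q @y h; rewrite n0 => x *;
    rewrite big_ord0.
  by rewrite n0; lra.
have n0' : 0 < n%:R :> R by rewrite ltr0n.
have : n%:R * (2 * s * y) <= n%:R * (q + n%:R * y ^+ 2).
  by have := sqr_ge0 (s - n%:R * y); nra.
by rewrite ler_pM2l//; nra.
Qed.

Lemma sum_ord_double (h : nat -> R) N :
  \sum_(i < N * 2) h i = \sum_(i < N) (h (i * 2)%N + h (i * 2).+1).
Proof.
elim: N => [|N IH]; first by rewrite !big_ord0.
by rewrite mulSn add2n !big_ord_recr /= IH addrA.
Qed.

Definition dyadic_pt a p (i : nat) : R := a + i%:R / 2 ^+ p.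

(** Both end points have full weight, as in a lattice point count; this excess over the trapezoidal
    rule makes the extreme values visible. *)
Definition dyadic_sum f a n p := \sum_(i < (n * 2 ^ p).+1) f (dyadic_pt a p i).

Definition dyadic_incr f a p (i : nat) :=
  f (dyadic_pt a p i.+1) - f (dyadic_pt a p i).

(** A discrete Dirichlet energy: the Riemann sum, with step [2 ^- p], for the integral of the
    squared derivative. *)
Definition dyadic_energy f a n p :=
  2 ^+ p * \sum_(i < n * 2 ^ p) dyadic_incr f a p i ^+ 2.

Lemma dyadic_pt_double a p i : dyadic_pt a p.+1 (i * 2) = dyadic_pt a p i.
Proof.
rewrite /dyadic_pt; congr (_ + _); rewrite natrM exprS; field.
by rewrite expf_neq0// pnatr_eq0.
Qed.

Lemma dyadic_incr_split f a p i :
  dyadic_incr f a p i =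
    dyadic_incr f a p.+1 (i * 2) + dyadic_incr f a p.+1 (i * 2).+1.
Proof.
by rewrite /dyadic_incr -[(i * 2).+2]/((i.+1) * 2)%N !dyadic_pt_double; ring.
Qed.

(** The parallelogram identity [2 (u^2 + v^2) = (u + v)^2 + (u - v)^2] for the increments [u], [v]
    over the two halves of a step; [u - v] is a second difference. *)
Lemma dyadic_energyS f a n p :
  dyadic_energy f a n p.+1 = dyadic_energy f a n p +
   2 ^+ p * \sum_(i < n * 2 ^ p)
     (dyadic_incr f a p.+1 (i * 2) - dyadic_incr f a p.+1 (i * 2).+1) ^+ 2.
Proof.
rewrite /dyadic_energy expnSr mulnA.
rewrite (sum_ord_double (fun i => dyadic_incr f a p.+1 i ^+ 2)).
rewrite exprS -mulrDr -big_split/= [2 * _]mulrC -mulrA; congr (_ * _).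
rewrite mulr_sumr; apply: eq_bigr => i _; rewrite (dyadic_incr_split f a p); ring.
Qed.

(** Refining adds the values at the midpoints, and each term of the last sum is twice a midpoint
    value minus the values at the ends of its step. An interior point ends two steps, [a] and
    [a + n] only one, whence the half sum. *)
Lemma dyadic_sumS f a n p :
  2 * dyadic_sum f a n p - dyadic_sum f a n p.+1 =
  (f a + f (a + n%:R)) / 2 -
  (\sum_(i < n * 2 ^ p)
     (dyadic_incr f a p.+1 (i * 2) - dyadic_incr f a p.+1 (i * 2).+1)) / 2.
Proof.
have p0 q : 2 ^+ q != 0 :> R by rewrite expf_neq0// pnatr_eq0.
rewrite /dyadic_sum expnSr mulnA.
have last_pt : dyadic_pt a p (n * 2 ^ p) = a + n%:R.
  by rewrite /dyadic_pt natrM natrX mulfK.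
have pt0 q : dyadic_pt a q 0 = a by rewrite /dyadic_pt mul0r addr0.
rewrite [X in _ - X]big_ord_recr /= dyadic_pt_double last_pt.
rewrite (sum_ord_double (fun i => f (dyadic_pt a p.+1 i))).
set N := (n * 2 ^ p)%N.
have e1 : \sum_(i < N.+1) f (dyadic_pt a p i) =
    \sum_(i < N) f (dyadic_pt a p i) + f (a + n%:R).
  by rewrite big_ord_recr/= last_pt.
have e2 : \sum_(i < N.+1) f (dyadic_pt a p i) =
    \sum_(i < N) f (dyadic_pt a p i.+1) + f a.
  by rewrite big_ord_recl/= pt0 addrC.
have -> : 2 * \sum_(i < N.+1) f (dyadic_pt a p i) =
    \sum_(i < N) (f (dyadic_pt a p i) + f (dyadic_pt a p i.+1)) + (f a + f (a + n%:R)).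
  by rewrite big_split/= mulr2n mulrDl mul1r {1}e1 e2; ring.
have -> : \sum_(i < N) (dyadic_incr f a p.+1 (i * 2) - dyadic_incr f a p.+1 (i * 2).+1)
  =
  \sum_(i < N) (f (dyadic_pt a p.+1 (i * 2)) + f (dyadic_pt a p.+1 (i * 2).+1)) * 2
    - \sum_(i < N) (f (dyadic_pt a p i) + f (dyadic_pt a p i.+1))
    - \sum_(i < N) f (dyadic_pt a p i) * 2.
  rewrite -!sumrB; apply: eq_bigr => i _.
  by rewrite /dyadic_incr -[(i * 2).+2]/((i.+1) * 2)%N !dyadic_pt_double; ring.
have : \sum_(i < N) f (dyadic_pt a p i) * 2 =
   \sum_(i < N) (f (dyadic_pt a p i) + f (dyadic_pt a p i.+1)) + (f a - f (a + n%:R)).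
  rewrite -mulr_suml big_split/=; move: e1 e2.
  move: (\sum_(i < N.+1) _) (f a) (f _) => X fa fb.
  move: (\sum_(i < N) _) (\sum_(i < N) _) => A B -> /eqP.
  by rewrite -subr_eq => /eqP <-; ring.
by rewrite -!mulr_suml; lra.
Qed.

(** Cauchy-Schwarz over the [n * 2 ^ p] steps: the factor [2 ^ p] is the one in front of the energy,
    so the bound does not deteriorate with [p]. *)
Lemma dyadic_trapezoid_error f a n p :
  (2 * dyadic_sum f a n p - dyadic_sum f a n p.+1
    - (f a + f (a + n%:R)) / 2) ^+ 2
  <= n%:R / 4 * (dyadic_energy f a n p.+1 - dyadic_energy f a n p).
Proof.
rewrite dyadic_sumS dyadic_energyS.
have := sqr_sum_le (fun i : 'I_(n * 2 ^ p) =>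
  dyadic_incr f a p.+1 (i * 2) - dyadic_incr f a p.+1 (i * 2).+1).
rewrite natrM natrX.
by set s := \sum_(i < _) _; set q := \sum_(i < _) _; nra.
Qed.

Lemma dyadic_energy_ge0 f a n p : 0 <= dyadic_energy f a n p.
Proof. by rewrite mulr_ge0 ?exprn_ge0// sumr_ge0// => i _; exact: sqr_ge0. Qed.

Lemma dyadic_energy_le f a n p C :
  (forall i, (i < n * 2 ^ p)%N -> `|dyadic_incr f a p i| <= C / 2 ^+ p) ->
  dyadic_energy f a n p <= n%:R * C ^+ 2.
Proof.
move=> h; have p0 : 0 < 2 ^+ p :> R by rewrite exprn_gt0.
have : \sum_(i < n * 2 ^ p) dyadic_incr f a p i ^+ 2 <=
    \sum_(i < n * 2 ^ p) (C / 2 ^+ p) ^+ 2.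
  apply: ler_sum => i _; rewrite -real_normK ?num_real//.
  by rewrite lerXn2r ?nnegrE//; [exact: le_trans (h i _)|exact: h].
rewrite sumr_const card_ord -[_ *+ (n * _)]mulr_natr natrM natrX => {}h.
rewrite /dyadic_energy mulrC -ler_pdivlMr//; apply: le_trans h _.
rewrite le_eqVlt; apply/orP; left; apply/eqP; field.
by rewrite gt_eqF.
Qed.

Lemma small_increment (e : nat -> R) K E : (0 < K)%N -> e K - e 0 <= E ->
  exists2 p, (p < K)%N & K%:R * (e p.+1 - e p) <= E.
Proof.
move=> K0 eE; apply: contrapT => h.
have : \sum_(i < K) E < \sum_(i < K) K%:R * (e i.+1 - e i).
  apply: ltr_sum; first by apply/hasP; exists (Ordinal K0); rewrite ?mem_index_enum.
  move=> i _; rewrite ltNge; apply/negP => hi; apply: h; by exists i.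
rewrite -mulr_sumr sumr_const card_ord -[E *+ K]mulr_natl ltr_pM2l ?ltr0n//.
rewrite -(big_mkord xpredT (fun i => e i.+1 - e i)) telescope_sumr//.
by lra.
Qed.

Lemma dyadic_compare f g a b n m K C :
  (0 < K)%N ->
  (forall p i, (p <= K)%N -> (i < n * 2 ^ p)%N ->
     `|dyadic_incr f a p i| <= C / 2 ^+ p) ->
  (forall p i, (p <= K)%N -> (i < m * 2 ^ p)%N ->
     `|dyadic_incr g b p i| <= C / 2 ^+ p) ->
  (forall p, (p <= K)%N -> dyadic_sum f a n p = dyadic_sum g b m p) ->
  (f a + f (a + n%:R) - (g b + g (b + m%:R))) ^+ 2 <=
    2 * ((n + m)%:R * C) ^+ 2 / K%:R.
Proof.
move=> K0 hf hg fg.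
have [|p pK /= pE] := @small_increment (fun p =>
  dyadic_energy f a n p + dyadic_energy g b m p) K
  ((n + m)%:R * C ^+ 2) K0.
  have := @dyadic_energy_le f a n K C (fun i => hf K i (leqnn K)).
  have := @dyadic_energy_le g b m K C (fun i => hg K i (leqnn K)).
  have := dyadic_energy_ge0 f a n 0; have := dyadic_energy_ge0 g b m 0.
  by rewrite natrD; lra.
have K0' : 0 < K%:R :> R by rewrite ltr0n.
rewrite ler_pdivlMr//.
have := dyadic_trapezoid_error f a n p; have := dyadic_trapezoid_error g b m p.
(* As [p < K], the sums agree at [p] and at [p.+1], so one number [S] approximates both half
   sums. *)
rewrite !fg// ?(ltnW pK)//.
have := dyadic_energyS f a n p; have := dyadic_energyS g b m p; move: pE.
set Ef := dyadic_energy f a n p; set Eg := dyadic_energy g b m p.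
set Ef' := dyadic_energy f a n p.+1; set Eg' := dyadic_energy g b m p.+1.
set dg := 2 ^+ p * _; set df := 2 ^+ p * _.
have dg0 : 0 <= dg by rewrite mulr_ge0 ?exprn_ge0// sumr_ge0// => i _; exact: sqr_ge0.
have df0 : 0 <= df by rewrite mulr_ge0 ?exprn_ge0// sumr_ge0// => i _; exact: sqr_ge0.
move=> h3 Eg'E Ef'E; move: h3; rewrite Eg'E Ef'E;
  rewrite [Ef + _]addrC [Eg + _]addrC !addrK.
have -> : df + Ef + (dg + Eg) - (Ef + Eg) = df + dg by ring.
rewrite natrD => h3.
set S := 2 * _ - _; set wf := f a + _; set wg := g b + _ => h1 h2.
have nm0 : 0 <= n%:R + m%:R :> R by rewrite addr_ge0.
have n0 : 0 <= n%:R :> R by []. have m0 : 0 <= m%:R :> R by [].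
(* [wf - wg] is twice the difference of the errors [S - wg / 2] and [S - wf / 2]; the square of a
   difference is at most twice the sum of the squares, hence 8. *)
have h4 : (wf - wg) ^+ 2 <= 8 * (n%:R / 4 * df + m%:R / 4 * dg).
  by have := sqr_ge0 ((S - wf / 2) + (S - wg / 2)); nra.
have h5 : (wf - wg) ^+ 2 <= 2 * (n%:R + m%:R) * (df + dg) by nra.
have h6 : (wf - wg) ^+ 2 * K%:R <= 2 * (n%:R + m%:R) * (df + dg) * K%:R.
  by rewrite ler_pM2r.
apply: le_trans h6 _.
have := ler_wpM2l nm0 h3; nra.
Qed.

End DyadicEnergy.

Local Open Scope classical_set_scope.

(** * Lebesgue measure on tuples *)

Section LebesgueTupleTheory.
Variable R : realType.
Local Notation TR := (measurableTypeR R).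
Local Notation mu m := (lebesgue_tuple R m).

Lemma lebesgue_measure_shift (c : R) (A : set TR) : measurable A ->
  lebesgue_measure ((fun x : TR => x + c : TR) @^-1` A) = lebesgue_measure A.
Proof.
have mshift : measurable_fun setT (fun x : TR => x + c : TR).
  exact: measurable_funD.
move=> mA; rewrite -[LHS]/(pushforward _ (fun x : TR => x + c : TR) A).
apply/esym/lebesgue_measure_unique => //= _ [[a b]] _ <-.
rewrite /pushforward.
have -> : (fun x : TR => x + c : TR) @^-1` `]a, b]%classic = `]a - c, b - c]%classic.
  by apply/seteqP; split => x /=; rewrite !in_itv/= ltrBlDr lerBrDr.
rewrite !lebesgue_measure_itv/= !lte_fin ltrD2r; case: ifPn => // _.
by rewrite -!EFinD; congr (_%:E); ring.
Qed.

Definition shift_tuple m (u t : m.-tuple TR) : m.-tuple TR :=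
  [tuple (tnth t i : R) + tnth u i | i < m].

Lemma measurable_shift_tuple m (u : m.-tuple TR) :
  measurable_fun setT (shift_tuple u).
Proof.
apply/measurable_fun_tnthP => i /=.
rewrite (_ : _ \o _ = (fun t => (tnth t i : R) + tnth u i)); last first.
  by apply/funext => t /=; rewrite tnth_mktuple.
by apply: measurable_funD => //; exact: measurable_tnth.
Qed.

Lemma shift_tuple_cons m (u : m.+1.-tuple TR) (x : TR) (t : m.-tuple TR) :
  shift_tuple u (tuple_cons (x, t)) =
  tuple_cons ((x : R) + tnth u ord0, shift_tuple [tuple of behead u] t).
Proof.
apply: eq_from_tnth => i; rewrite tnth_mktuple.
case: (unliftP ord0 i) => [j ->|->].
  by rewrite !tnthS tnth_mktuple tnth_behead; congr (_ + tnth _ _); apply/val_inj;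
    rewrite /= inordK// ltnS.
by rewrite !tnth0.
Qed.

(** Fubini along the first coordinate: the sections are translates, handled by induction, and the
    outer integral is invariant in dimension one. *)
Lemma lebesgue_tuple_shift m (u : m.-tuple TR) (A : set (m.-tuple TR)) :
  measurable A -> mu m (shift_tuple u @^-1` A) = mu m A.
Proof.
elim: m u A => [|m IH] u A mA.
  suff -> : shift_tuple u = id by [].
  by apply/funext => t; apply: eq_from_tnth => -[].
rewrite /= /lebesgue_cons /pushforward.
set B := tuple_cons (m:=m) @^-1` A.
have mB : measurable B.
  by rewrite /B -[X in measurable X]setTI; exact: measurable_tuple_cons.
pose G x := mu m (xsection B x).
rewrite /product_measure1; pose s0 : TR -> TR := fun x => (x : R) + tnth u ord0.
transitivity (\int[lebesgue_measure]_x (G \o s0) x)%E.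
  apply: eq_integral => x _; rewrite /= /G -(IH [tuple of behead u]);
    last exact: measurable_xsection.
  congr (mu m _); apply/seteqP; split => t; rewrite /xsection/= !inE /=;
    by rewrite /B/= shift_tuple_cons.
have mshift : measurable_fun setT s0.
  exact: measurable_funD.
have mG : measurable_fun setT G by exact: measurable_fun_xsection.
rewrite -[X in (\int[_]_(x in X) _)%E](preimage_setT s0).
rewrite -ge0_integral_pushforward//.
apply: eq_measure_integral => A' mA' _; exact: lebesgue_measure_shift.
Qed.

Definition cube m (lo hi : R) : set (m.-tuple TR) :=
  [set t | forall i, lo <= tnth t i <= hi].

Arguments cube : clear implicits.

Lemma measurable_cube m lo hi : measurable (cube m lo hi).
Proof.
rewrite (_ : cube _ _ _ = \bigcap_(i : 'I_m) ((fun t : m.-tuple TR =>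
  tnth t i) @^-1` `[lo, hi]%classic)).
  apply: fin_bigcap_measurable => // i _.
  by rewrite -[X in measurable X]setTI; exact: measurable_tnth.
apply/seteqP; split => t /= h; first by move=> i _ /=; rewrite in_itv/=.
by move=> i; have := h i I; rewrite /= in_itv.
Qed.

Lemma lebesgue_cube m lo hi : lo <= hi -> mu m (cube m lo hi) = ((hi - lo) ^+ m)%:E.
Proof.
move=> lohi; elim: m => [|m IH].
  by rewrite /= /dirac indicE mem_set//= => -[].
rewrite /= /lebesgue_cons /pushforward.
rewrite (_ : _ @^-1` _ = `[lo, hi]%classic `*` cube m lo hi).
  rewrite product_measure1E//; last exact: measurable_cube.
  rewrite exprS EFinM IH; congr (_ * _)%E.
  rewrite -[LHS]/(lebesgue_measure `[lo, hi]%classic) lebesgue_measure_itv/= lte_fin;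
    case: ltgtP lohi => //= -> _.
  by rewrite subrr.
apply/seteqP; split => -[x t] /=.
  move=> h; split.
    by have := h ord0; rewrite in_itv/= tnth0.
  by move=> i; have := h (lift ord0 i); rewrite tnthS.
move=> [+ h] i; rewrite in_itv/= => hx.
case: (unliftP ord0 i) => [j ->|->]; last by rewrite tnth0.
by rewrite tnthS.
Qed.

End LebesgueTupleTheory.
Arguments cube {R} m lo hi.

(** * Volume and grid points *)

Section VolumeCount.
Variables (R : realType) (m : nat) (A : 'M[R]_m).
Local Notation TR := (measurableTypeR R).
Hypothesis Au : A \in unitmx.

Definition tuple_row (t : m.-tuple TR) : 'rV[R]_m := \row_j (tnth t j : R).

Definition row_tuple (v : 'rV[R]_m) : m.-tuple TR := [tuple v 0 i : TR | i < m].

(** The measure lives in the coordinates [t], the grid in the coordinates [t *m A]. Volumes are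
    compared only with one another, by translating and counting, so the determinant of [A] never
    enters. *)
Definition lin_coord (t : m.-tuple TR) : 'rV[R]_m := tuple_row t *m A.

(* The Lebesgue measure on [R^m] transported by [A]. *)
Definition lin_vol (K : set 'rV[R]_m) : \bar R :=
  lebesgue_tuple R m (lin_coord @^-1` K).

Definition lin_measurable (K : set 'rV[R]_m) := measurable (lin_coord @^-1` K).

Lemma lin_coord_shift (g : 'rV[R]_m) t :
  lin_coord (shift_tuple (row_tuple (g *m invmx A)) t) = lin_coord t + g.
Proof.
rewrite /lin_coord -[in RHS](mulmxKV Au g) -mulmxDl; congr (_ *m _).
by apply/rowP => i; rewrite !mxE tnth_mktuple tnth_mktuple mxE.
Qed.

Lemma lin_measurable_shift K g :
  lin_measurable K -> lin_measurable [set c | K (c + g)].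
Proof.
rewrite /lin_measurable => mK.
rewrite (_ : _ @^-1` _ = shift_tuple (row_tuple (g *m invmx A)) @^-1` (lin_coord @^-1`
  K)).
  by rewrite -[X in measurable X]setTI; exact: measurable_shift_tuple.
by apply/seteqP; split => t /=; rewrite lin_coord_shift.
Qed.

Lemma lin_vol_shift K g :
  lin_measurable K -> lin_vol [set c | K (c + g)] = lin_vol K.
Proof.
move=> mK; rewrite /lin_vol -(lebesgue_tuple_shift (row_tuple (g *m invmx A)) mK).
by congr (lebesgue_tuple R m _); apply/seteqP; split => t /=; rewrite lin_coord_shift.
Qed.

Lemma measurable_lin_coord (i : 'I_m) :
  measurable_fun setT (fun t => lin_coord t 0 i : TR).
Proof.
rewrite (_ : (fun _ => _) = (fun t : m.-tuple TR => \sum_j (tnth t j : R) * A j i)).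
  apply: measurable_sum => j; apply: measurable_funM => //.
  exact: measurable_tnth.
by apply/funext => t; rewrite mxE; apply: eq_bigr => j _; rewrite mxE.
Qed.

(** Half-open, so that the cells at the grid points tile without overlap. *)
Definition cell (g : 'rV[R]_m) k : set 'rV[R]_m :=
  [set c | forall i, 0 <= c 0 i - g 0 i < k%:R^-1].

Lemma lin_measurable_cell g k : lin_measurable (cell g k).
Proof.
rewrite /lin_measurable (_ : _ @^-1` _ = \bigcap_(i : 'I_m)
    ((fun t => lin_coord t 0 i : TR) @^-1` `[g 0 i, g 0 i + k%:R^-1[%classic)).
  apply: fin_bigcap_measurable => // i _.
  by rewrite -[X in measurable X]setTI; exact: measurable_lin_coord.
apply/seteqP; split => t /= h.
  by move=> i _ /=; have := h i; rewrite in_itv/= subr_ge0 ltrBlDl.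
by move=> i; have := h i I; rewrite /= in_itv/= subr_ge0 ltrBlDl.
Qed.

Lemma lin_measurableI K K' :
  lin_measurable K -> lin_measurable K' -> lin_measurable (K `&` K').
Proof. by move=> mK mK'; rewrite /lin_measurable preimage_setI; exact: measurableI. Qed.

Definition window (M : nat) : set 'rV[R]_m := [set c | forall i, `|c 0 i| <= M%:R].

Lemma cell_disjoint M k (o o' : {ffun 'I_m -> 'I_(2 * M * k).+1}) c :
  (0 < k)%N -> cell (gridpt R o) k c -> cell (gridpt R o') k c -> o = o'.
Proof.
move=> k0 co co'; apply/ffunP => i; apply/val_inj => /=.
have k0' : 0 < k%:R :> R by rewrite ltr0n.
have := co i; have := co' i; rewrite !mxE.
set x := (o' i : nat); set y := (o i : nat) => /andP[h1 h2] /andP[h3 h4].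
have step (p q : nat) : (p%:R / k%:R < q%:R / k%:R + k%:R^-1 :> R) -> (p <= q)%N.
  by rewrite -{3}[k%:R^-1]mul1r -mulrDl ltr_pM2r ?invr_gt0// natr1 ltr_nat ltnS.
by apply/eqP; rewrite eqn_leq !step//; lra.
Qed.

Lemma cell_cover M k c : (0 < k)%N -> window M c ->
  exists o : {ffun 'I_m -> 'I_(2 * M * k).+1}, cell (gridpt R o) k c.
Proof.
move=> k0 cM.
have k0' : 0 < k%:R :> R by rewrite ltr0n.
pose f i : nat := Num.truncn ((c 0 i + M%:R) * k%:R).
have cM0 i : 0 <= (c 0 i + M%:R) * k%:R.
  by rewrite mulr_ge0 ?(ltW k0')//; have := cM i; rewrite ler_norml; lra.
have fM i : (f i < (2 * M * k).+1)%N.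
  rewrite ltnS /f -(ler_nat R); apply: (@le_trans _ _ ((c 0 i + M%:R) * k%:R)).
    by rewrite truncn_le.
  by rewrite !natrM ler_pM2r//; have := cM i; rewrite ler_norml; lra.
exists [ffun i => Ordinal (fM i)] => i; rewrite !mxE ffunE /=.
have /andP[h1 h2] := truncn_itv (cM0 i).
rewrite -/(f i) in h1 h2.
have -> : c 0 i - ((f i)%:R / k%:R - M%:R) =
  ((c 0 i + M%:R) * k%:R - (f i)%:R) / k%:R by field; rewrite gt_eqF.
apply/andP; split; first by rewrite divr_ge0 ?subr_ge0// ltW.
by rewrite -[X in _ < X]mul1r ltr_pM2r ?invr_gt0// ltrBlDl natr1.
Qed.

Lemma lin_vol_cells M k K : (0 < k)%N -> lin_measurable K -> K `<=` window M ->
  lin_vol K = (\sum_(o : {ffun 'I_m -> 'I_(2 * M * k).+1})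
    lin_vol (K `&` cell (gridpt R o) k))%E.
Proof.
move=> k0 mK KM.
pose F (o : {ffun 'I_m -> 'I_(2 * M * k).+1}) :=
  lin_coord @^-1` (K `&` cell (gridpt R o) k).
rewrite /lin_vol (_ : _ @^-1` K = \bigcup_o F o).
  rewrite measure_fin_bigcup//.
  - rewrite [RHS]fsbig_seq ?index_enum_uniq//;
    rewrite (_ : [set` index_enum _] = setT)//.
    by apply/seteqP; split => // o _ /=; rewrite mem_index_enum.
  - exact: finite_finset.
  - move=> o o' _ _ [t [[_ to] [_ to']]]; exact: cell_disjoint to to'.
  - by move=> o _; apply: lin_measurableI => //; exact: lin_measurable_cell.
apply/seteqP; split => [t Kt|t [ o _ []]//].
by have [ o oP] := cell_cover k0 (KM _ Kt); exists o.
Qed.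

Lemma lin_vol_cell_shift K k g : lin_measurable K ->
  lin_vol (K `&` cell g k) = lin_vol ([set c | K (c + g)] `&` cell 0 k).
Proof.
move=> mK; rewrite -(lin_vol_shift g); last first.
  by apply: lin_measurableI => //; exact: lin_measurable_cell.
congr lin_vol; apply/seteqP; split => c /= [Kc cc]; split => // i;
  by have := cc i; rewrite !mxE subr0 addrK.
Qed.

(* Cutting [K] along the grid cells and translating the pieces into the cell at 0
   shows that the volume of [K] is the integral over this cell of the number of
   grid points in the translates of [K]. *)
Lemma lin_vol_integral M k K : (0 < k)%N -> lin_measurable K -> K `<=` window M ->
  lin_vol K = (\int[lebesgue_tuple R m]_(t in lin_coord @^-1` cell 0 k)
    (gcount M k [set c | K (lin_coord t + c)])%:R%:E)%E.
Proof.
move=> k0 mK KM; rewrite (lin_vol_cells k0 mK KM).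
pose G (o : {ffun 'I_m -> 'I_(2 * M * k).+1}) :=
  lin_coord @^-1` [set c | K (c + gridpt R o)].
have mG o : measurable (G o) by exact: lin_measurable_shift.
have mC : measurable (lin_coord @^-1` cell 0 k) by exact: lin_measurable_cell.
transitivity (\int[lebesgue_tuple R m]_(t in lin_coord @^-1` cell 0 k)
    (\sum_(o : {ffun 'I_m -> 'I_(2 * M * k).+1}) (\1_(G o) t)%:E))%E.
  rewrite ge0_integral_sum//; last first.
    by move=> o; apply: measurable_funTS; apply/measurable_EFinP;
      exact: measurable_indic.
  apply: eq_bigr => o _; rewrite integral_indic//.
  exact: lin_vol_cell_shift.
apply: eq_integral => t _; rewrite sumEFin; congr (_%:E).
rewrite /gcount -sum1_card natr_sum [in RHS]big_mkcond/=; apply: eq_bigr => o _.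
rewrite indicE finset.inE /=; case: asboolP => [Ko|nKo]; first by rewrite mem_set.
by rewrite memNset.
Qed.

(** The error term of [gcount_thicken] for [eps = 1 / k], where [2 * (eps * k + 1)] is 4. *)
Definition gcount_error M k : R := m%:R * (((2 * M * k).+1 ^ m.-1)%N%:R * 4).

Lemma gcount_shift_error M k K (c : 'rV[R]_m) : (0 < k)%N -> is_convex K -> cell 0 k c
  ->
  (gcount M k [set x | K (c + x)])%:R <= (gcount M k K)%:R + gcount_error M k /\
  (gcount M k K)%:R <= (gcount M k [set x | K (c + x)])%:R + gcount_error M k.
Proof.
move=> k0 cK cc; have k0' : 0 < k%:R :> R by rewrite ltr0n.
have ck i : `|c 0 i| <= k%:R^-1.
  by have := cc i; rewrite mxE subr0 => /andP[c0 /ltW]; rewrite ger0_norm.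
have -> : gcount_error M k =
    m%:R * (((2 * M * k).+1 ^ m.-1)%N%:R * (2 * (k%:R^-1 * k%:R + 1))).
  by rewrite /gcount_error mulVf ?gt_eqF//; congr (_ * (_ * _)); lra.
split; apply: gcount_thicken; rewrite ?invr_ge0 ?(ltW k0')//.
- by move=> x Kx; exists c => //; rewrite addrC.
- move=> x y s Kx Ky s01; have := cK _ _ _ Kx Ky s01; rewrite /=.
  rewrite !scalerDr addrACA -scalerDl.
  by rewrite subrKC scale1r.
- move=> x Kx; exists (- c); first by move=> i; rewrite mxE normrN.
  by rewrite /= addrC subrK.
Qed.

(** The integrand of [lin_vol_integral] is within [gcount_error] of the constant [gcount M k K].
    Errors are added, never subtracted: the volumes are extended reals not yet known to be
    finite. *)
Lemma lin_vol_gcount M k K : (0 < k)%N -> is_convex K -> lin_measurable K ->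
  K `<=` window M ->
  (lin_vol K <= ((gcount M k K)%:R + gcount_error M k)%:E * lin_vol (cell 0 k))%E /\
  ((gcount M k K)%:R%:E * lin_vol (cell 0 k) <=
     lin_vol K + (gcount_error M k)%:E * lin_vol (cell 0 k))%E.
Proof.
move=> k0 cK mK KM; rewrite (lin_vol_integral k0 mK KM).
have mC : measurable (lin_coord @^-1` cell 0 k) by exact: lin_measurable_cell.
have e0 : 0 <= gcount_error M k by rewrite /gcount_error !mulr_ge0.
have mg : measurable_fun (lin_coord @^-1` cell 0 k) (fun t =>
    ((gcount M k [set c | K (lin_coord t + c)])%:R : R)%:E).
  pose G (o : {ffun 'I_m -> 'I_(2 * M * k).+1}) :=
    lin_coord @^-1` [set c | K (c + gridpt R o)].
  apply: measurable_funTS; apply/measurable_EFinP.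
  rewrite (_ : (fun _ => _) = (fun t =>
    \sum_(o : {ffun 'I_m -> 'I_(2 * M * k).+1}) \1_(G o) t)).
    by apply: measurable_sum => o; apply: measurable_indic; exact: lin_measurable_shift.
  apply/funext => t; rewrite /gcount -sum1_card natr_sum big_mkcond/=;
    apply: eq_bigr => o _.
  rewrite indicE finset.inE /=; case: asboolP => [Ko|nKo]; first by rewrite mem_set.
  by rewrite memNset.
split.
  rewrite /lin_vol -integral_cst//; apply: ge0_le_integral => //.
  by move=> t tC; rewrite lee_fin; have [] := gcount_shift_error M k0 cK tC.
rewrite /lin_vol -!integral_cst// -ge0_integralD//; apply: ge0_le_integral => //.
- by move=> t _; rewrite lee_fin.
- by apply: emeasurable_funD.
- by move=> t tC; rewrite /= -EFinD lee_fin; have [] := gcount_shift_error M k0 cK tC.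
Qed.

End VolumeCount.

(** * Grid points of the unit cell and the order of the counting error *)

Section GridCells.
Variables (R : realType) (m : nat).

Lemma mulmx_bounded p q (B : 'M[R]_(p, q)) : exists N : nat,
  forall c : 'rV[R]_p, (forall i, `|c 0 i| <= 1) -> forall i, `|(c *m B) 0 i| <= N%:R.
Proof.
pose s := \sum_i \sum_j `|B i j|.
have s0 : 0 <= s by rewrite sumr_ge0// => i _; rewrite sumr_ge0.
exists (Num.truncn s).+1 => c hc i.
have /andP[_ /ltW hs] := truncn_itv s0; apply: le_trans hs.
rewrite mxE; apply: le_trans (ler_norm_sum _ _ _) _; apply: ler_sum => j _.
rewrite normrM; apply: le_trans (_ : 1 * `|B j i| <= _); first exact: ler_wpM2r.
by rewrite mul1r (bigD1 i)//= lerDl sumr_ge0.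
Qed.

Lemma cell_convex g k : is_convex (cell g k : set 'rV[R]_m).
Proof.
move=> x y s xc yc s01 i; rewrite !mxE.
have /andP[x0 x1] := xc i; have /andP[y0 y1] := yc i.
have -> : s * x 0 i + (1 - s) * y 0 i - g 0 i =
  s * (x 0 i - g 0 i) + (1 - s) * (y 0 i - g 0 i) by ring.
move: x0 x1 y0 y1; set a := _ - _; set b := y 0 i - _; set t := k%:R^-1.
move=> a0 a1 b0 b1; apply/andP; split; first by nra.
have [->|s0] := eqVneq s 0; first by lra.
have sp : 0 < s by rewrite lt_neqAle eq_sym s0; lra.
have : s * a < s * t by rewrite ltr_pM2l.
have : (1 - s) * b <= (1 - s) * t by apply: ler_wpM2l; lra.
lra.
Qed.

Lemma cell0P k (c : 'rV[R]_m) : cell 0 k c <-> forall i, 0 <= c 0 i < k%:R^-1.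
Proof. by split => h i; have := h i; rewrite [X in _ - X]mxE subr0. Qed.

Lemma gcount_cell1 M k : (0 < M)%N -> (0 < k)%N ->
  gcount M k (cell 0 1 : set 'rV[R]_m) = (k ^ m)%N.
Proof.
move=> M0 k0; have k0' : 0 < k%:R :> R by rewrite ltr0n.
(* The index [p] stands for [p / k - M], so coordinates in [[0, 1[] have the [k] indices from
   [M * k] on. *)
pose S := [pred p : 'I_(2 * M * k).+1 | (M * k <= p < M * k + k)%N].
have cS : #|S| = k.
  have lt_B (j : 'I_k) : (M * k + j < (2 * M * k).+1)%N.
    by rewrite ltnS -mulnA mul2n -addnn leq_add2l (leq_trans (ltnW (ltn_ord j)))//
      leq_pmull.
  pose f (j : 'I_k) : 'I_(2 * M * k).+1 := Ordinal (lt_B j).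
  have fi : injective f by move=> i j /(congr1 val)/addnI/val_inj.
  rewrite -[RHS]card_ord -(fintype.card_image fi); apply: eq_card => p;
    rewrite !finset.inE.
  apply/idP/fintype.imageP => [/andP[h1 h2]|[j _ ->]]; last first.
    by rewrite /= leq_addr ltn_add2l ltn_ord.
  have h3 : (p - M * k < k)%N by rewrite ltn_subLR.
  by exists (Ordinal h3) => //; apply/val_inj; rewrite /= subnKC.
rewrite -[m in RHS]card_ord -[k in RHS]cS -card_ffun_on /gcount; apply: eq_card => o.
rewrite finset.inE; apply/asboolP/ffun_onP => [/cell0P h i|h]; last (apply/cell0P => i);
  have := h i; rewrite !finset.inE !mxE invr1.
  rewrite subr_ge0 ltrBlDr ler_pdivlMr// ltr_pdivrMr// -natrM ler_nat => /andP[-> h2]/=.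
  by move: h2; rewrite -[1]/(1%:R) -natrD -natrM ltr_nat mulnDl mul1n addnC.
move=> /andP[h1 h2]; rewrite subr_ge0 ltrBlDr ler_pdivlMr// ltr_pdivrMr// -natrM
  ler_nat h1/=.
by rewrite -[1]/(1%:R) -natrD -natrM ltr_nat mulnDl mul1n addnC.
Qed.

(** As [2 M k + 1 <= 3 M k], the error is [O(k ^ (m - 1))]; multiplying by [k] lets one formula
    include [m = 0]. *)
Lemma gcount_error_le M k : (0 < M)%N -> (0 < k)%N ->
  gcount_error R m M k * k%:R <= m%:R * ((3 * M) ^ m.-1 * 4)%N%:R * k%:R ^+ m.
Proof.
move=> M0 k0; rewrite /gcount_error; case: m => [|n]; first by rewrite !mul0r.
have hB : ((2 * M * k).+1 ^ n <= (3 * M) ^ n * k ^ n)%N.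
  by rewrite -expnMn; case: n => // n; rewrite leq_exp2r//; nia.
rewrite -natrX -!natrM ler_nat succnK expnS.
move: (_ ^ n)%N ((3 * M) ^ n)%N (k ^ n)%N hB => a b c h.
rewrite [X in (_ <= X)%N](_ : _ = n.+1 * 4 * k * (b * c))%N; last by ring.
rewrite [X in (X <= _)%N](_ : _ = n.+1 * 4 * k * a)%N; last by ring.
by rewrite leq_mul2l h orbT.
Qed.

End GridCells.

(** * Volume ratios from grid counts *)

Section VolumeRatio.
Variables (R : realType) (m : nat) (A : 'M[R]_m).
Hypothesis Au : A \in unitmx.

Lemma lin_vol_cell1_fin : (lin_vol A (cell 0 1) < +oo)%E.
Proof.
have [N hN] := mulmx_bounded (invmx A).
have h : (lin_vol A (cell 0 1) <= lebesgue_tuple R m (cube m (- N%:R) N%:R))%E.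
  apply: le_measure; rewrite ?inE; [exact: lin_measurable_cell|exact: measurable_cube|].
  move=> t /= tc i; rewrite -ler_norml.
  have := hN (lin_coord A t) _ i; rewrite /lin_coord mulmxK// mxE; apply.
  move=> j; have /cell0P/(_ j) := tc; rewrite invr1 => /andP[t0 /ltW].
  by rewrite ger0_norm.
apply: le_lt_trans h _.
by rewrite lebesgue_cube ?ltry//; have : 0 <= N%:R :> R by []; lra.
Qed.

Lemma lin_vol_cell_fin k : (0 < k)%N -> lin_vol A (cell 0 k) \is a fin_num.
Proof.
move=> k0; rewrite ge0_fin_numE; last exact: measure_ge0.
apply: le_lt_trans lin_vol_cell1_fin; apply: le_measure; rewrite ?inE.
- exact: lin_measurable_cell.
- exact: lin_measurable_cell.
- move=> t /= tc i; have := tc i => /andP[-> h]/=; apply: lt_le_trans h _.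
  by rewrite invr1 invf_le1 ?ler1n ?ltr0n.
Qed.

(** If a cell had measure 0, then by [lin_vol_gcount] so would every bounded measurable convex set;
    but the image of the closed unit cube under [A] has measure 1. *)
Lemma lin_vol_cell_gt0 k : (0 < k)%N -> 0 < fine (lin_vol A (cell 0 k)).
Proof.
move=> k0; have fk := lin_vol_cell_fin k0.
rewrite lt_neqAle; apply/andP; split; last by apply: fine_ge0; exact: measure_ge0.
apply/negP => /eqP v0; have [N hN] := mulmx_bounded A.
pose K : set 'rV[R]_m := [set c | forall i, 0 <= (c *m invmx A) 0 i <= 1].
have preK : lin_coord A @^-1` K = cube m 0 1.
  by apply/seteqP; split => t /= h i; have := h i; rewrite /lin_coord mulmxK// mxE.
have cK : is_convex K.
  move=> x y s Kx Ky s01 i; have := Kx i; have := Ky i.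
  rewrite mulmxDl -!scalemxAl; move: (x *m _) (y *m _) => a b; rewrite !mxE.
  by move: (a 0 i) (b 0 i) => {}a {}b; nra.
have mK : lin_measurable A K by rewrite /lin_measurable preK; exact: measurable_cube.
have KN : K `<=` window N.
  move=> c Kc i; rewrite -(mulmxKV Au c); apply: hN => j.
  by have /andP[? ?] := Kc j; rewrite ger0_norm.
have [+ _] := lin_vol_gcount Au k0 cK mK KN.
rewrite /lin_vol preK lebesgue_cube// -[lebesgue_tuple R m _](fineK fk) -v0 mule0.
by rewrite subr0 expr1n lee_fin ler10.
Qed.

(** With [v] the volume of a small cell and [E] the error, [K] has volume [v * (gcount M k K)] and
    the unit cell [v * k ^ m], both up to [v * E]. Eliminating the volumes and dividing by [v]
    leaves [(1 + rho) * E]. *)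
Lemma lin_vol_ratio M k K (rho := fine (lin_vol A K) / fine (lin_vol A (cell 0 1))) :
  (0 < M)%N -> (0 < k)%N -> is_convex K -> lin_measurable A K -> K `<=` window M ->
  `|(gcount M k K)%:R - rho * k%:R ^+ m| <= (1 + rho) * gcount_error R m M k.
Proof.
move=> M0 k0 cK mK KM.
have D_window : (cell 0 1 : set 'rV[R]_m) `<=` window M.
  move=> c /cell0P h i; have := h i; rewrite invr1 => /andP[c0 /ltW c1].
  by rewrite ger0_norm// (le_trans c1)// ler1n.
have fk := lin_vol_cell_fin k0; have vk := lin_vol_cell_gt0 k0.
have f1 := lin_vol_cell_fin (ltn0Sn 0); have v1 := lin_vol_cell_gt0 (ltn0Sn 0).
have [K1 K2] := lin_vol_gcount Au k0 cK mK KM.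
have [D1 D2] := lin_vol_gcount Au k0 (@cell_convex _ _ 0 1) (lin_measurable_cell A 0 1)
  D_window.
have fK : lin_vol A K \is a fin_num.
  rewrite ge0_fin_numE; last exact: measure_ge0.
  by apply: le_lt_trans K1 _; rewrite -(fineK fk) -EFinM ltry.
have rhoE : fine (lin_vol A K) = rho * fine (lin_vol A (cell 0 1)).
  by rewrite /rho divfK// gt_eqF.
have rho0 : 0 <= rho by rewrite divr_ge0// ?(ltW v1)// fine_ge0//; exact: measure_ge0.
move: K1 K2 D1 D2; rewrite gcount_cell1// -(fineK fk) -(fineK f1) -(fineK fK).
rewrite -!EFinM -!EFinD !lee_fin rhoE natrX.
move: (fine _) (fine _) vk v1 => v vD vk v1.
set N := (gcount M k K)%:R; set E := gcount_error _ _ _ _; set q := k%:R ^+ m.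
move=> K1 K2 D1 D2; rewrite ler_norml; apply/andP; split.
  rewrite -(ler_pM2r vk); have := ler_wpM2l rho0 D2; nra.
by rewrite -(ler_pM2r vk); have := ler_wpM2l rho0 D1; nra.
Qed.

(* A closed bounded set is the intersection over [k] of the unions of the grid
   cells of side [1/k] meeting it. *)
Lemma lin_measurable_closed M (K : set 'rV[R]_m) : K `<=` window M ->
  (forall c : 'rV[R]_m, (forall k, (0 < k)%N -> exists2 x, K x & forall i,
    `|x 0 i - c 0 i| <= k%:R^-1) -> K c) ->
  lin_measurable A K.
Proof.
move=> KM clK.
pose Oc k := [set o : {ffun 'I_m -> 'I_(2 * M * k.+1).+1} | K `&` cell (gridpt R o)
  k.+1 !=set0].
rewrite /lin_measurable (_ : _ @^-1` _ = \bigcap_k \bigcup_(o in Oc k) lin_coord A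
  @^-1` cell (gridpt R o) k.+1).
  apply: bigcapT_measurable => k; apply: fin_bigcup_measurable.
    exact: finite_finset.
  by move=> o _; exact: lin_measurable_cell.
apply/seteqP; split => t /= h.
  move=> k _; have [ o oP] := cell_cover (ltn0Sn k) (KM _ h).
  by exists o => //; exists (lin_coord A t).
apply: clK => -[//|k] _; have [ o [x [Kx xo]] to] := h k I.
exists x => // i; have /andP[x0 /ltW x1] := xo i; have /andP[t0 /ltW t1] := to i.
rewrite ler_norml; move: x0 x1 t0 t1;
  move: (x 0 i) (gridpt R o 0 i) (lin_coord A t 0 i) => a b c.
by move: (k.+1%:R^-1) => q *; apply/andP; split; lra.
Qed.

End VolumeRatio.

(** * Closedness of linear images of a cube *)

Section ClosedSimplex.
Import numFieldNormedType.Exports.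

(** By compactness of the cube the total deviation from [y] attains its minimum, which the
    hypothesis makes smaller than any positive number. *)
Lemma lin_system_closed (R : realType) r n (B : 'M[R]_(r, n)) (y : 'rV[R]_n) :
  (forall e : R, 0 < e -> exists2 l : 'rV[R]_r,
    (forall j, 0 <= l 0 j <= 1) & forall i, `|(l *m B) 0 i - y 0 i| <= e) ->
  exists2 l : 'rV[R]_r, (forall j, 0 <= l 0 j <= 1) & l *m B = y.
Proof.
move=> h.
pose f (l : 'rV[R]_r) : R := \sum_i `|(\sum_j l 0 j * B j i) - y 0 i|.
pose S := [set l : 'rV[R]_r | forall j, `[0, 1]%classic (l ord0 j)].
have cS : compact S.
  apply: (@rV_compact R^o r (fun=> `[0, 1]%classic)) => j.
  exact: segment_compact.
have S0 : S !=set0.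
  have [l hl _] := h 1 ltr01; exists l => j /=; rewrite in_itv/=; exact: hl.
have cf : continuous f.
  apply: continuous_big => [|i _]; first exact: add_continuous.
  have cs : continuous (fun l : 'rV[R]_r => \sum_j l 0 j * B j i : R).
    apply: continuous_big => [|j _]; first exact: add_continuous.
    move=> l.
    apply: (@cvgM _ _ _ _ (fun l : 'rV[R]_r => l 0 j) (fun=> B j i)).
    - exact: (nbhs_filter l).
    - exact: (@coord_continuous R 1 r 0 j l).
    - by apply: cvg_cst; exact: (nbhs_filter l).
  move=> l; have fl : Filter (nbhs l) := nbhs_filter l.
  pose cy := @cvg_cst R^o (y 0 i) _ (nbhs l) fl.
  exact: (@cvg_norm _ _ _ _ fl _ _ (@cvgB _ _ _ _ fl _ _ _ _ (cs l) cy)).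
have [l + lmin] := EVT_min_rV S0 cS (continuous_subspaceT cf).
rewrite inE => lS; exists l; first by move=> j; have := lS j; rewrite /= in_itv.
suff fl0 : f l = 0.
  apply/rowP => i; apply/eqP; rewrite -subr_eq0 -normr_eq0 mxE.
  have /psumr_eq0P/(_ fl0) := (fun i (_ : true) =>
    normr_ge0 ((\sum_j l 0 j * B j i) - y 0 i)).
  by move=> ->.
have f0 : 0 <= f l by apply: sumr_ge0.
apply/eqP; rewrite eq_le f0 andbT; apply/ler_addgt0Pr => e e0; rewrite add0r.
(* Dividing by [n.+1] rather than [n] covers [n = 0]. *)
have [l' l'S l'e] := h (e / n.+1%:R) (divr_gt0 e0 (ltr0Sn _ _)).
apply: le_trans (lmin l' _) _; first by rewrite inE => j /=; rewrite in_itv/=;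
  exact: l'S.
apply: le_trans (_ : \sum_(i < n) e / n.+1%:R <= _).
  by apply: ler_sum => i _; have := l'e i; rewrite mxE.
rewrite sumr_const card_ord -[_ *+ n]mulr_natr -mulrA ler_piMr ?(ltW e0)//.
by rewrite mulrC ler_pdivrMr ?ltr0Sn// mul1r ler_nat.
Qed.

End ClosedSimplex.

(** * Polytopes *)

Section Polytope.
Variables (R : realType) (V : vectType R).

Lemma convex_setP (A : set V) : convex_set (A : set (convex_lmodType V)) <-> is_convex
  A.
Proof.
split => cA.
  move=> x y s Ax Ay /andP[s0 s1].
  by have := cA x y (Itv01 s0 s1) (mem_set Ax) (mem_set Ay); rewrite inE.
move=> x y s; rewrite !inE => Ax Ay; apply: cA => //.
by apply/andP; split.
Qed.

Definition simplex r : set 'rV[R]_r :=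
  [set l | (forall j, 0 <= l 0 j) /\ \sum_j l 0 j = 1].

Definition comb r (v : 'I_r -> V) (l : 'rV[R]_r) : V := \sum_j l 0 j *: v j.

Lemma is_convex_comb (A : set V) r (v : 'I_r -> V) l :
  is_convex A -> (forall j, A (v j)) -> simplex l -> A (comb v l).
Proof.
move=> cA; elim: r v l => [|r IH] v l Av [l0 l1].
  by move: l1; rewrite big_ord0 => /eqP; rewrite eq_sym oner_eq0.
rewrite /comb big_ord_recl/=; move: l1; rewrite big_ord_recl/= => l1.
pose t := \sum_(j < r) l 0 (lift ord0 j).
have tE : t = 1 - l 0 ord0 by rewrite -l1 addrC addKr.
have t0 : 0 <= t by apply: sumr_ge0.
have [t00|tn0] := eqVneq t 0.
  have lz j : l 0 (lift ord0 j) = 0.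
    by have /psumr_eq0P/(_ t00) := (fun j (_ : true) => l0 (lift ord0 j)); exact.
  rewrite big1 ?addr0; last by move=> j _; rewrite lz scale0r.
  have -> : l 0 ord0 = 1 by lra.
  by rewrite scale1r; exact: Av.
have tp : 0 < t by rewrite lt_neqAle eq_sym tn0.
have -> : \sum_(j < r) l 0 (lift ord0 j) *: v (lift ord0 j) =
  (1 - l 0 ord0) *: comb (fun j => v (lift ord0 j)) (\row_j (l 0 (lift ord0 j) / t)).
  rewrite -tE /comb scaler_sumr; apply: eq_bigr => j _.
  by rewrite mxE scalerA mulrC divfK.
apply: cA => //; last by rewrite l0/=; lra.
apply: IH => //; split.
  by move=> j; rewrite mxE divr_ge0.
under eq_bigr do rewrite mxE.
by rewrite -mulr_suml divff.
Qed.

Lemma comb_convex r (v : 'I_r -> V) : is_convex [set x | exists2 l,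
  simplex l & x = comb v l].
Proof.
move=> _ _ s [l [l0 l1] ->] [l' [l'0 l'1] ->] /andP[s0 s1].
exists (s *: l + (1 - s) *: l').
  split; first by move=> j; rewrite !mxE addr_ge0// mulr_ge0// subr_ge0.
  by under eq_bigr do rewrite !mxE;
    rewrite big_split/= -!mulr_sumr l1 l'1 !mulr1 subrKC.
rewrite /comb !scaler_sumr -big_split/=; apply: eq_bigr => j _.
by rewrite !mxE [RHS]scalerDl !scalerA.
Qed.

Lemma comb_vertex r (v : 'I_r -> V) j : v j = comb v (delta_mx 0 j).
Proof.
rewrite /comb (bigD1 j)//= mxE !eqxx scale1r big1 ?addr0// => i /negPf ij.
by rewrite mxE ij andbF scale0r.
Qed.

Lemma simplex_delta r (j : 'I_r) : simplex (delta_mx 0 j : 'rV[R]_r).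
Proof.
split; first by move=> i; rewrite mxE.
rewrite (bigD1 j)//= mxE !eqxx big1 ?addr0// => i /negPf ij.
by rewrite mxE ij andbF.
Qed.

(* The weight of the vertices below the top one, which are at height at most
   [h j0 - 1], is at most [h j0 - t]; moving the right proportion of it to [j0]
   raises the point to height [s]. *)
Lemma simplex_raise r (h : 'I_r -> R) (j0 : 'I_r) (l : 'rV[R]_r) (s : R) :
  (forall j, h j = h j0 \/ h j <= h j0 - 1) -> simplex l ->
  \sum_j l 0 j * h j <= s <= h j0 ->
  exists2 l', simplex l' & \sum_j l' 0 j * h j = s /\
    \sum_j `|l' 0 j - l 0 j| <= 2 * (s - \sum_j l 0 j * h j).
Proof.
move=> hj [l0 l1]; set t := \sum_j _ => /andP[ts sb].
have [st|nst] := eqVneq s t.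
  exists l => //; split => //; rewrite st subrr mulr0 big1// => j _.
  by rewrite subrr normr0.
have lt_ts : t < s by rewrite lt_neqAle eq_sym nst.
have bt : 0 < h j0 - t by lra.
pose lam := (s - t) / (h j0 - t).
have lam01 : 0 <= lam <= 1.
  by rewrite /lam divr_ge0/= ?ler_pdivrMr//; lra.
pose q j : R := if h j == h j0 then 0 else l 0 j.
have q0 j : 0 <= q j by rewrite /q; case: ifP.
have ql j : q j <= l 0 j by rewrite /q; case: ifP.
pose mu := \sum_j q j.
have mu0 : 0 <= mu by apply: sumr_ge0.
have btE : h j0 - t = \sum_j q j * (h j0 - h j).
  have {1}-> : h j0 = \sum_j l 0 j * h j0 by rewrite -mulr_suml l1 mul1r.
  by rewrite /t -sumrB; apply: eq_bigr => j _; rewrite /q; case: eqP => [->|_]; ring.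
have mu_le : mu <= h j0 - t.
  rewrite btE; apply: ler_sum => j _; rewrite /q; case: eqP => [_|nh];
    first by rewrite mul0r.
  by case: (hj j) => [//|hle]; rewrite ler_peMr//; lra.
pose l' : 'rV[R]_r := \row_j (l 0 j - lam * q j + (if j == j0 then lam * mu else 0)).
have sum_top (F : 'I_r -> R) : \sum_j (if j == j0 then lam * mu else 0) * F j = lam *
  mu * F j0.
  rewrite (bigD1 j0)//= eqxx big1 ?addr0// => j /negPf ->; exact: mul0r.
exists l'; first split.
- move=> j; rewrite mxE addr_ge0//; last by case: ifP => // _; rewrite mulr_ge0//; lra.
  by have := q0 j; have := ql j; nra.
- under eq_bigr do rewrite mxE; rewrite big_split/= sumrB l1 -mulr_sumr -/mu.
  have -> : \sum_j (if j == j0 then lam * mu else 0) = lam * mu.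
    rewrite -[RHS]mulr1 -(sum_top (fun=> 1)); apply: eq_bigr => j _.
    by rewrite mulr1.
  by rewrite addrNK.
split.
  under eq_bigr do rewrite mxE mulrDl mulrBl.
  rewrite big_split/= sumrB sum_top -/t.
  under [X in _ - X]eq_bigr do rewrite -mulrA.
  rewrite -mulr_sumr.
  have -> : \sum_j q j * h j = mu * h j0 - (h j0 - t).
    by rewrite btE /mu mulr_suml -sumrB; apply: eq_bigr => j _; ring.
  by rewrite /lam; field; rewrite gt_eqF.
(* The moved weight [lam * mu] counts twice, where it leaves and where it arrives; by [mu_le] it is
   at most [s - t]. *)
apply: le_trans (_ : \sum_j (lam * q j + (if j == j0 then lam * mu else 0) * 1) <= _).
  apply: ler_sum => j _; rewrite mxE mulr1.
  have : 0 <= lam * q j by rewrite mulr_ge0//; lra.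
  have : 0 <= lam * mu by rewrite mulr_ge0//; lra.
  by move=> ? ?; rewrite ler_norml; case: ifP => _; apply/andP; split; lra.
rewrite big_split/= sum_top -mulr_sumr -/mu mulr1.
have : lam * (h j0 - t) = s - t by rewrite /lam divfK// gt_eqF.
have : lam * mu <= lam * (h j0 - t) by apply: ler_wpM2l => //; lra.
lra.
Qed.

End Polytope.

(** * Lattice bases adapted to a primitive functional *)

Section AdaptedBasis.
Variables (R : realType) (V : vectType R).
Implicit Types (L : set V) (z : 'Hom(V, R^o)).

Lemma inIntSpanP n (b : n.-tuple V) x :
  inIntSpan b x <-> exists c : 'I_n -> int, x = \sum_i (c i)%:~R *: tnth b i.
Proof.
split=> [[a ->]|[c ->]].
  by exists a; apply: eq_bigr => i _; rewrite (tnth_nth 0) scaler_int.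
by exists [ffun i => c i]; apply: eq_bigr => i _; rewrite ffunE (tnth_nth 0) scaler_int.
Qed.

(** [lattice] fixes the length of the basis to be the dimension; a length [n] tied to it by an
    equation can be replaced by [d.+1]. *)
Lemma lattice_intro n (b : n.-tuple V) (A : set V) : n = \dim {:V} ->
  basis_of fullv b -> A = [set v | inIntSpan b v] -> lattice A.
Proof. by move=> nV; subst n; exists b. Qed.

Lemma lattice_elim L : lattice L -> exists n (b : n.-tuple V),
  [/\ n = \dim {:V}, basis_of fullv b &
      forall x, L x <-> exists c : 'I_n -> int, x = \sum_i (c i)%:~R *: tnth b i].
Proof.
move=> [b [bb ->]]; exists (\dim {:V}), b; split => // x.
exact: inIntSpanP.
Qed.

Definition lin_comb d (e : 'I_d -> V) (c : 'rV[R]_d) : V := \sum_i c 0 i *: e i.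

(* A basis [w, e_1, .., e_d] of [L] with [e_1, .., e_d] in the kernel of [z] and
   [z w = 1]; [X] reads off the coordinates along the [e_i]. *)
Definition adapted L z d (e : 'I_d -> V) (w : V) (X : V -> 'rV[R]_d) : Prop :=
  [/\ \dim {:V} = d.+1, (forall i, z (e i) = 0 :> R), z w = 1 :> R,
      (forall x, L x <-> exists (c : 'I_d -> int) (j : int),
         x = \sum_i (c i)%:~R *: e i + j%:~R *: w) &
      [/\ linear X, (forall c t, X (lin_comb e c + t *: w) = c) &
          forall x, x = lin_comb e (X x) + (z x : R) *: w]].

Lemma linear_functional_comb z d (e : 'I_d -> V) c w t :
  (forall i, z (e i) = 0 :> R) -> z (lin_comb e c + t *: w) = t * z w :> R.
Proof.
move=> ze; rewrite linearD linearZ /= /lin_comb linear_sum big1 ?add0r// => i _.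
by rewrite linearZ /= ze; exact: mulr0.
Qed.

(** By Smith normal form the values of [z] on the basis are [h] times the first column of a
    unimodular [P]. If [|h| > 1], then [z / |h|] is integral on [L] and [z] is not primitive; if
    [h = 0], then [z = 0]. So [h] is a unit and [h P^-1] is the required matrix. *)
Lemma primitive_column L z n (b : n.+1.-tuple V) (a : 'cV[int]_n.+1) :
  (forall x, L x <-> exists c : 'I_n.+1 -> int, x = \sum_i (c i)%:~R *: tnth b i) ->
  basis_of fullv b -> primitive L z ->
  (forall i, (a i 0)%:~R = z (tnth b i) :> R) ->
  exists2 N : 'M[int]_n.+1, N \in unitmx & N *m a = delta_mx 0 0.
Proof.
move=> Lb bb [zdual z0 zprim] az.
have [P Pu [Q Qu [dl _ aE]]] := int_Smith_normal_form a.
pose h : int := dl`_0 * Q 0 0.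
have aP i : a i 0 = P i 0 * h.
  rewrite aE mxE big_ord1 /h mulrA.
  congr (_ * _).
  rewrite mxE (bigD1 ord0)//= !mxE mulr1n big1 ?addr0// => j j0.
  by rewrite mxE; case: j j0 => -[|j] //= ? _; rewrite mulr0n mulr0.
have z_ext (z' : 'Hom(V, R^o)) : (forall i, z' (tnth b i) = z (tnth b i)) -> z' = z.
  move=> zz; apply/lfunP => x; have /coord_basis : x \in {:V}%VS by exact: memvf.
  move=> /(_ _ _ bb) ->; rewrite !linear_sum; apply: eq_bigr => i _.
  by rewrite !linearZ /= -!tnth_nth zz.
have h0 : h != 0.
  apply/eqP => h0; move/eqP: z0; apply; apply/esym; apply: z_ext => i.
  by rewrite lfunE /= -az aP h0 mulr0.
have h1 : `|h| = 1.
  apply/eqP; rewrite eq_le; apply/andP; split; last by rewrite -gtz0_ge1 normr_gt0.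
  rewrite leNgt; apply/negP => hgt; apply: zprim.
  exists ((`|h|%:~R : R)^-1 *: z), `|h|; split => //.
    move=> x /Lb[c ->]; rewrite linear_sum; apply: rpred_sum => i _.
    rewrite linearZ /=; apply: rpredM; first exact: rpred_int.
    rewrite lfunE /= -az aP rmorphM /=.
    have hR : `|h|%:~R != 0 :> R by rewrite intr_eq0 normr_eq0.
    suff -> : (`|h|%:~R : R)^-1 *: ((P i 0)%:~R * h%:~R : R^o) = (P i 0 * Num.sg h)%:~R.
      exact: rpred_int.
    have hE : h%:~R = (Num.sg h)%:~R * `|h|%:~R :> R by rewrite -intrM -numEsg.
    rewrite -[LHS]/((`|h|%:~R : R)^-1 * ((P i 0)%:~R * h%:~R)) hE intrM.
    by move: (`|h|%:~R) hR => u u0; field.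
  apply: esym; apply: z_ext => i; rewrite -scaler_int lfunE /= lfunE /=.
  by rewrite scalerA divff ?scale1r// intr_eq0 normr_eq0.
have hh : h * h = 1 by case: (intP h) h1 => //= -[|m]//; rewrite ?normrN//= => -[].
exists (h *: invmx P).
  by rewrite unitmxZ ?unitmx_inv//; apply/unitrP; exists h.
apply/matrixP => i j; rewrite (ord1 j) -scalemxAl.
have -> : a = P *m (h *: delta_mx 0 0).
  apply/colP => k; rewrite -scalemxAr !mxE aP mulrC; congr (_ * _).
  rewrite (bigD1 ord0)//= mxE !eqxx mulr1 big1 ?addr0// => l /negPf l0.
  by rewrite mxE l0 mulr0.
by rewrite mulKmx// scalerA hh scale1r.
Qed.

(** The rows of the matrix from [primitive_column], read in the basis [b], form a basis of [L] on
    which [z] takes the values 1, 0, .., 0: its first vector is [w], the others are the [e i]. *)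
Lemma adapted_exists L z : lattice L -> primitive L z -> (1 <= \dim {:V})%N ->
  exists d (e : 'I_d -> V) w X, adapted L z e w X.
Proof.
move=> /lattice_elim[n [b [nV bb Lb]]] zprim dimV.
case: n b nV bb Lb => [|d] b nV bb Lb; first by move: dimV; rewrite -nV.
have Lbi i : L (tnth b i).
  apply/Lb; exists (fun j => (i == j)%:R); rewrite (bigD1 i)//= eqxx scale1r.
  by rewrite big1 ?addr0// => j; rewrite eq_sym => /negPf ->; rewrite scale0r.
have [zdual _ _] := zprim.
pose a : 'cV[int]_d.+1 := \col_i Num.floor (z (tnth b i) : R).
have az i : (a i 0)%:~R = z (tnth b i) :> R.
  by rewrite mxE; apply/eqP; rewrite -intrEfloor; exact: zdual.
have [N Nu Na] := primitive_column Lb bb zprim az.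
pose b' i : V := \sum_j (N i j)%:~R *: tnth b j.
have zb' i : z (b' i) = (i == 0)%:R :> R.
  rewrite linear_sum; transitivity (((N *m a) i 0)%:~R : R); last first.
    by rewrite Na mxE andbT; case: (_ == _).
  rewrite mxE rmorph_sum; apply: eq_bigr => j _.
  by rewrite linearZ /= -az rmorphM.
have Lb' x : L x <-> exists c : 'I_d.+1 -> int, x = \sum_i (c i)%:~R *: b' i.
  split=> [/Lb[c ->]|[c ->]].
    exists (fun i => ((\row_j c j) *m invmx N) 0 i).
    have cE j : c j = \sum_i ((\row_j c j) *m invmx N) 0 i * N i j.
      have := mulmxKV Nu (\row_j c j) => /rowP/(_ j); rewrite !mxE => <-.
      by apply: eq_bigr.
    under eq_bigr do rewrite cE rmorph_sum scaler_suml.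
    rewrite exchange_big; apply: eq_bigr => i _; rewrite scaler_sumr.
    by apply: eq_bigr => j _; rewrite rmorphM scalerA.
  apply/Lb; exists (fun j => \sum_i c i * N i j).
  under eq_bigr do rewrite scaler_sumr.
  rewrite exchange_big; apply: eq_bigr => j _; rewrite rmorph_sum scaler_suml.
  by apply: eq_bigr => i _; rewrite rmorphM scalerA.
pose bt : d.+1.-tuple V := [tuple b' i | i < d.+1].
have btE i : tnth bt i = b' i by rewrite tnth_mktuple.
have bbt : basis_of fullv bt.
  rewrite basisEdim size_tuple -nV leqnn andbT.
  rewrite -(span_basis bb); apply/span_subvP => _ /tnthP[i ->].
  have [c ->] := (Lb' _).1 (Lbi i).
  by apply: memv_suml => j _; rewrite memvZ// -btE memv_span// mem_tnth.
pose e (i : 'I_d) := b' (lift ord0 i).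
pose X x : 'rV[R]_d := \row_i coord bt (lift ord0 i) x.
have Xb c t : X (lin_comb e c + t *: b' ord0) = c.
  apply/rowP => i; rewrite mxE.
  pose k (l : 'I_d.+1) : R := if unlift ord0 l is Some l' then c 0 l' else t.
  have -> : lin_comb e c + t *: b' ord0 = \sum_l k l *: bt`_l.
    rewrite big_ord_recl /= addrC /k unlift_none; congr (_ *: _ + _).
      by rewrite -[RHS](tnth_nth 0 bt ord0) btE.
    apply: eq_bigr => l _; rewrite liftK; congr (_ *: _).
    by rewrite -[RHS](tnth_nth 0 bt (lift ord0 l)) btE.
  by rewrite coord_sum_free ?(basis_free bbt)// /k liftK.
have Xz x : x = lin_comb e (X x) + (z x : R) *: b' ord0.
  have xE : x = lin_comb e (X x) + coord bt ord0 x *: b' ord0.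
    rewrite {1}(coord_basis bbt (memvf x)) big_ord_recl addrC /=; congr (_ + _ *: _).
      apply: eq_bigr => i _; rewrite mxE; congr (_ *: _).
      by rewrite -[LHS](tnth_nth 0 bt (lift ord0 i)) btE.
    by rewrite -[LHS](tnth_nth 0 bt ord0) btE.
  have := congr1 z xE; rewrite linear_functional_comb; last by move=> i; rewrite zb'.
  by rewrite zb' mulr1 => zx; rewrite [in RHS]zx -xE.
exists d, e, (b' ord0), X; split.
- by rewrite nV.
- by move=> i; rewrite zb'.
- by rewrite zb'.
- move=> x; split=> [/Lb'[c ->]|[c [j ->]]].
    by exists (fun i => c (lift ord0 i)), (c ord0); rewrite big_ord_recl addrC.
  apply/Lb'; exists (fun l => if unlift ord0 l is Some l' then c l' else j).
  rewrite big_ord_recl unlift_none addrC; congr (_ + _).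
  by apply: eq_bigr => i _; rewrite liftK.
- split=> //; move=> s x y; apply/rowP => i; rewrite !mxE linearP.
  by [].
Qed.

Lemma adapted_lattice L z d (e : 'I_d -> V) w X (k m : nat) : (0 < k)%N -> (0 < m)%N ->
  adapted L z e w X ->
  let L' := [set x | exists (c : 'I_d -> int) (j : int),
    x = \sum_i ((c i)%:~R / k%:R) *: e i + (j%:~R / m%:R) *: w] in
  lattice L' /\ L `<=` L'.
Proof.
move=> k0 m0 [dV ze zw LE [linX Xc xX]] L'.
have kn0 : k%:R != 0 :> R by rewrite pnatr_eq0 -lt0n.
have mn0 : m%:R != 0 :> R by rewrite pnatr_eq0 -lt0n.
split; last first.
  move=> x /LE[c [j ->]]; exists (fun i => c i * k%:Z), (j * m%:Z).
  rewrite rmorphM /= mulfK//; congr (_ + _); apply: eq_bigr => i _.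
  by rewrite rmorphM /= mulfK.
pose b : d.+1.-tuple V := [tuple of (m%:R^-1 *: w) :: [tuple (k%:R^-1 *: e i) | i < d]].
have b0 : tnth b ord0 = m%:R^-1 *: w by rewrite tnth0.
have bS i : tnth b (lift ord0 i) = k%:R^-1 *: e i by rewrite tnthS tnth_mktuple.
apply: (lattice_intro (n := d.+1) (b := b)) => //.
  rewrite basisEdim size_tuple dV leqnn andbT; apply/subvP => x _.
  rewrite (xX x) rpredD//.
    apply: memv_suml => i _; rewrite -[e i](scalerKV kn0) -bS scalerA memvZ//.
    by rewrite memv_span// mem_tnth.
  by rewrite -[w](scalerKV mn0) -b0 scalerA memvZ// memv_span// mem_tnth.
apply/seteqP; split=> x /=.
  move=> [c [j ->]]; apply/inIntSpanP.
  exists (fun l => if unlift ord0 l is Some l' then c l' else j).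
  rewrite big_ord_recl unlift_none b0 scalerA addrC; congr (_ + _).
  by apply: eq_bigr => i _; rewrite liftK bS scalerA.
move=> /inIntSpanP[c ->]; exists (fun i => c (lift ord0 i)), (c ord0).
rewrite big_ord_recl b0 scalerA addrC; congr (_ + _).
by apply: eq_bigr => i _; rewrite bS scalerA.
Qed.

End AdaptedBasis.

(** * Counting points of refined lattices *)

Section LatticeCount.
Variables (R : realType) (V : vectType R).

Lemma card_fset_set_image (T : finType) (W : choiceType) (f : T -> W)
    (Q : {pred T}) (S : set W) : {in Q &, injective f} ->
  (forall x, S x <-> exists2 t, t \in Q & x = f t) -> #|` fset_set S| = #|Q|.
Proof.
move=> finj Sf.
have SE : S = f @` [set` Q].
  apply/seteqP; split => x; first by move=> /Sf[t tQ ->]; exists t.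
  by move=> [t tQ <-]; apply/Sf; exists t.
have finS : finite_set S by rewrite SE; apply: finite_image; exact: finite_finset.
have -> : fset_set S = [fset x in map f (enum Q)]%fset.
  apply/fsetP => x; rewrite in_fset_set// finmap.inE; apply/idP/mapP.
    by rewrite inE => /Sf[t tQ ->]; exists t; rewrite ?mem_enum.
  by move=> [t]; rewrite mem_enum => tQ ->; rewrite inE; apply/Sf; exists t.
rewrite card_fseq undup_id ?size_map -?cardE//.
by rewrite map_inj_in_uniq ?enum_uniq// => t t'; rewrite !mem_enum; exact: finj.
Qed.

Definition gridset d (p : V) (e : 'I_d -> V) (k : nat) : set V :=
  [set x | exists c : 'I_d -> int, x = p + \sum_i ((c i)%:~R / k%:R) *: e i].

Lemma gridpt_int d M k (c : 'I_d -> int) : (0 < k)%N ->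
  (forall i, `|(c i)%:~R / k%:R| <= M%:R :> R) ->
  exists o : {ffun 'I_d -> 'I_(2 * M * k).+1},
    gridpt R o = \row_i ((c i)%:~R / k%:R).
Proof.
move=> k0 cM; have k0' : 0 < k%:R :> R by rewrite ltr0n.
have cb i : (- (M * k)%N%:Z <= c i) && (c i <= (M * k)%N%:Z).
  have := cM i; rewrite ler_norml ler_pdivlMr// ler_pdivrMr// mulNr.
  by rewrite -!(ler_int R) mulrNz -!pmulrn natrM.
have cB i : (absz (c i + (M * k)%N%:Z)%R < (2 * M * k).+1)%N by have := cb i; lia.
exists [ffun i => Ordinal (cB i)]; apply/rowP => i; rewrite !mxE ffunE /=.
have -> : (absz (c i + (M * k)%N%:Z)%R)%:R = (c i)%:~R + M%:R * k%:R :> R.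
  rewrite pmulrn gez0_abs; last by have := cb i; lia.
  by rewrite intrD -pmulrn natrM.
by field; rewrite gt_eqF.
Qed.

Lemma gridpt_intE d M k (o : {ffun 'I_d -> 'I_(2 * M * k).+1}) (i : 'I_d) :
  (0 < k)%N -> gridpt R o 0 i = ((o i)%:Z - (M * k)%N%:Z)%:~R / k%:R.
Proof.
move=> k0; rewrite mxE intrB -!pmulrn natrM mulrBl mulfK//.
by rewrite pnatr_eq0 -lt0n.
Qed.

Lemma gridpt_inj d M k : (0 < k)%N ->
  injective (fun o : {ffun 'I_d -> 'I_(2 * M * k).+1} => gridpt R o).
Proof.
move=> k0 o o' /rowP oo'; apply/ffunP => i; apply/val_inj/eqP => /=.
have := oo' i; rewrite !mxE => /addIr /mulIf h.
by rewrite -(eqr_nat R); apply/eqP/h; rewrite invr_eq0 pnatr_eq0 -lt0n.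
Qed.

Lemma card_gridset d (e : 'I_d -> V) (p : V) M k (F : set V) : (0 < k)%N ->
  injective (lin_comb e) ->
  [set c | F (p + lin_comb e c)] `<=` window M ->
  #|` fset_set (F `&` gridset p e k)| = gcount M k [set c | F (p + lin_comb e c)].
Proof.
move=> k0 einj FM; rewrite /gcount.
apply: (card_fset_set_image (f :=
  fun o : {ffun 'I_d -> 'I_(2 * M * k).+1} => p + lin_comb e (gridpt R o))).
  by move=> o o' _ _ /addrI/einj/(gridpt_inj k0).
move=> x; split.
  move=> [Fx [c xE]]; have xE' : x = p + lin_comb e (\row_i ((c i)%:~R / k%:R)).
    by rewrite xE; congr (_ + _); apply: eq_bigr => i _; rewrite mxE.
  have [|o oE] := gridpt_int (M := M) (c := c) k0.
    by move=> i; have := FM (\row_i ((c i)%:~R / k%:R)); rewrite /= -xE' => /(_ Fx i);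
      rewrite mxE.
  by exists o; rewrite ?oE// finset.inE; apply/asboolP; rewrite /= oE -xE'.
move=> [ o]; rewrite finset.inE => /asboolP Fo ->; split => //.
exists (fun i => (o i)%:Z - (M * k)%N%:Z); congr (_ + _).
by apply: eq_bigr => i _; rewrite gridpt_intE.
Qed.

(** Since [a] is an integer, the multiples of [1 / m] between [a] and [a + n] are the [a + i / m]
    with [i <= n * m]. A point determines its layer through [z] and its grid position through
    [X]. *)
Lemma card_layers d (e : 'I_d -> V) (w : V) (X : V -> 'rV[R]_d) (z : 'Hom(V, R^o))
    (L : set V) M k m (a : int) (n : nat) (P : set V) :
  (0 < k)%N -> (0 < m)%N -> adapted L z e w X ->
  (forall x, P x -> a%:~R <= (z x : R) <= a%:~R + n%:R) ->
  (forall t, [set c | P (lin_comb e c + t *: w)] `<=` window M) ->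
  universal_count P [set x | exists (c : 'I_d -> int) (j : int),
    x = \sum_i ((c i)%:~R / k%:R) *: e i + (j%:~R / m%:R) *: w] =
  \sum_(i < (n * m).+1)
    gcount M k [set c | P (lin_comb e c + (a%:~R + i%:R / m%:R) *: w)].
Proof.
move=> k0 m0 [dV ze zw LE [linX Xc xX]] Pz PM.
have m0' : 0 < m%:R :> R by rewrite ltr0n.
pose T := ('I_(n * m).+1 * {ffun 'I_d -> 'I_(2 * M * k).+1})%type.
pose ht (i : 'I_(n * m).+1) : R := a%:~R + i%:R / m%:R.
pose f (t : T) : V := lin_comb e (gridpt R t.2) + ht t.1 *: w.
pose Q := [pred t : T | `[< P (f t) >]].
have zf t : z (f t) = ht t.1 :> R by rewrite linear_functional_comb// zw mulr1.
rewrite /universal_count (card_fset_set_image (f := f) (Q := Q)).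
- rewrite -sum1_card.
  rewrite -(pair_big_dep predT (fun i o => Q (i, o)) (fun _ _ => 1%N)) /=.
  by apply: eq_bigr => i _; rewrite /gcount -sum1_card; apply: eq_bigl => o;
    rewrite finset.inE.
- move=> [i o] [i' o'] _ _ ff.
  have := congr1 X ff; rewrite /f !Xc => /(gridpt_inj k0) /= ->.
  congr pair; have := congr1 (fun x => z x : R) ff;
    rewrite !zf /ht /= => /addrI /mulIf h.
  by apply/val_inj/eqP; rewrite -(eqr_nat R); apply/eqP/h; rewrite invr_eq0 gt_eqF.
move=> x; split.
  move=> [Px [c [j xE]]].
  have xE' : x = lin_comb e (\row_i ((c i)%:~R / k%:R)) + (j%:~R / m%:R) *: w.
    by rewrite xE; congr (_ + _); apply: eq_bigr => i _; rewrite mxE.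
  have zx : z x = j%:~R / m%:R :> R by rewrite xE' linear_functional_comb// zw mulr1.
  have [|o oE] := gridpt_int (M := M) (c := c) k0.
    by move=> i; have := PM _ (\row_i ((c i)%:~R / k%:R));
      rewrite /= => /(_ (j%:~R / m%:R)); rewrite -xE' => /(_ Px i); rewrite mxE.
  have jb : (a * m%:Z <= j) && (j <= a * m%:Z + (n * m)%N%:Z).
    have := Pz _ Px; rewrite zx ler_pdivlMr// ler_pdivrMr// mulrDl.
    by rewrite -!(ler_int R) intrD !intrM -!pmulrn natrM.
  have jB : (absz (j - a * m%:Z)%R < (n * m).+1)%N by lia.
  have htE : ht (Ordinal jB) = j%:~R / m%:R.
    rewrite /ht /= pmulrn gez0_abs; last by lia.
    by rewrite intrB intrM -pmulrn; field; rewrite gt_eqF.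
  exists (Ordinal jB, o); last by rewrite /f /= oE htE -xE'.
  by apply: asboolT; rewrite /f /= oE htE -xE'.
move=> [[i o] /asboolW Pf ->]; split => //.
exists (fun i => (o i)%:Z - (M * k)%N%:Z), (a * m%:Z + i%:Z); congr (_ + _).
  by apply: eq_bigr => j _; rewrite /= gridpt_intE.
congr (_ *: _); rewrite /ht intrD intrM -!pmulrn; field; rewrite gt_eqF//.
Qed.

End LatticeCount.

(** * Lattice polytopes as images of simplices *)

Section PolytopeVertices.
Variables (R : realType) (V : vectType R).

Definition hull_of (P : set V) r (v : 'I_r -> V) : Prop :=
  forall x, P x <-> exists2 l : 'rV[R]_r, simplex l & x = comb v l.

Lemma lattice_polytope_vertices (L P : set V) : lattice_polytope L P ->
  exists r (v : 'I_r -> V), [/\ (0 < r)%N, (forall j, L (v j)) & hull_of P v].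
Proof.
move=> [S [/finite_seqP[s ->] [x0 x0s] SL ->]].
exists (size s), (tnth (in_tuple s)); split.
- by case: s x0s {SL}.
- by move=> j; apply: SL; rewrite /= mem_tnth.
move=> x; split.
  move: x; apply: (@smallest_sub _ _ _ [set x | exists2 l : 'rV[R]__, simplex l &
      x = comb (tnth (in_tuple s)) l]).
    by apply/convex_setP; exact: comb_convex.
  move=> y /= /(nthP 0)[j js <-].
  exists (delta_mx 0 (Ordinal js)); first exact: simplex_delta.
  by rewrite -comb_vertex (tnth_nth 0).
move=> [l ls ->] A [/convex_setP cA SA]; apply: is_convex_comb => // j.
by apply: SA; rewrite /= mem_tnth.
Qed.

Variables (P : set V) (r : nat) (v : 'I_r -> V).
Hypothesis Pv : hull_of P v.

Lemma hull_convex : is_convex P.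
Proof.
move=> x y s /Pv Px /Pv Py s01; apply/Pv.
exact: (comb_convex (v := v)).
Qed.

Lemma hull_vertex j : P (v j).
Proof. by apply/Pv; exists (delta_mx 0 j);
  [exact: simplex_delta|exact: comb_vertex]. Qed.



Lemma linear_comb_sum (W : lmodType R) (f : V -> W) (fl : linear f) l :
  f (comb v l) = \sum_j l 0 j *: f (v j).
Proof.
pose g : {linear V -> W} := HB.pack f (GRing.isLinear.Build _ _ _ _ f fl).
rewrite -[f]/(g : V -> W) /comb linear_sum; apply: eq_bigr => j _; exact: linearZ.
Qed.

Lemma hull_bounded m (X : V -> 'rV[R]_m) : linear X ->
  exists2 M : nat, (0 < M)%N & forall x, P x -> forall i, `|X x 0 i| <= M%:R.
Proof.
move=> Xl; pose s := \sum_j \sum_i `|X (v j) 0 i|.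
have s0 : 0 <= s by apply: sumr_ge0 => j _; apply: sumr_ge0.
exists (Num.truncn s).+1 => // x /Pv[l [l0 l1] ->] i.
have /andP[_ /ltW hs] := truncn_itv s0; apply: le_trans hs.
rewrite linear_comb_sum// summxE; apply: le_trans (ler_norm_sum _ _ _) _.
apply: ler_sum => j _; rewrite mxE normrM ger0_norm//.
apply: le_trans (_ : 1 * `|X (v j) 0 i| <= _).
  apply: ler_wpM2r => //; rewrite -l1 (bigD1 j)//= lerDl.
  by apply: sumr_ge0.
by rewrite mul1r (bigD1 i)//= lerDl sumr_ge0.
Qed.

(** Membership in [P] is solvability of a linear system in the weights, with a column of ones
    expressing that they sum to 1. The measurability of slices rests on this. *)
Lemma hull_closed n (X : V -> 'rV[R]_n) x : linear X -> injective X ->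
  (forall eps : R, 0 < eps -> exists2 y, P y & forall i, `|X y 0 i - X x 0 i| <= eps) ->
  P x.
Proof.
move=> Xl Xi h.
pose B : 'M[R]_(r, n.+1) := \matrix_(j,
  i) if unlift ord0 i is Some i' then X (v j) 0 i' else 1.
pose b : 'rV[R]_n.+1 := \row_i if unlift ord0 i is Some i' then X x 0 i' else 1.
have BE l (i : 'I_n) : (l *m B) 0 (lift ord0 i) = X (comb v l) 0 i.
  rewrite linear_comb_sum// mxE summxE; apply: eq_bigr => j _.
  by rewrite !mxE liftK.
have B0 l : (l *m B) 0 ord0 = \sum_j l 0 j.
  by rewrite mxE; apply: eq_bigr => j _; rewrite mxE unlift_none mulr1.
have [|l l01 lB] := @lin_system_closed R r n.+1 B b.
  move=> eps eps0; have [y /Pv[l [l0 l1] ->] hy] := h eps eps0; exists l.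
    by move=> j; rewrite l0 -l1 (bigD1 j)//= lerDl sumr_ge0.
  move=> i; case: (unliftP ord0 i) => [i' ->|->].
    by rewrite BE mxE liftK.
  by rewrite B0 mxE unlift_none l1 subrr normr0 ltW.
apply/Pv; exists l.
  by split; [move=> j; have /andP[] := l01 j|rewrite -B0 lB mxE unlift_none].
apply: Xi; apply/rowP => i; have := congr1 (fun u : 'rV_n.+1 => u 0 (lift ord0 i)) lB.
by rewrite BE mxE liftK.
Qed.

End PolytopeVertices.

(** * Grids and relative volume in lattice coordinates *)

Section RelativeVolume.
Variables (R : realType) (V : vectType R).
Implicit Types (L F P : set V) (z : 'Hom(V, R^o)).

(** The integral shift [a] of the base point is [a * k] steps of the mesh. Used both ways, this
    shows that two bases of one lattice define the same grid at every mesh. *)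
Lemma gridset_sub d m (e : 'I_d -> V) (e' : 'I_m -> V) p q k
    (a : 'I_m -> int) (E : 'I_d -> 'I_m -> int) : (0 < k)%N ->
  p = q + \sum_j (a j)%:~R *: e' j ->
  (forall i, e i = \sum_j (E i j)%:~R *: e' j) ->
  gridset p e k `<=` gridset q e' k.
Proof.
move=> k0 -> eE _ [c ->]; have kn0 : k%:R != 0 :> R by rewrite pnatr_eq0 -lt0n.
exists (fun j => a j * k%:Z + \sum_i c i * E i j).
rewrite -addrA; congr (_ + _).
under [X in _ + X]eq_bigr do rewrite eE scaler_sumr.
rewrite exchange_big -big_split /=; apply: eq_bigr => j _.
under eq_bigr do rewrite scalerA.
rewrite -scaler_suml -scalerDl; congr (_ *: _).
rewrite intrD intrM rmorph_sum /= mulrDl mulfK//; congr (_ + _).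
by rewrite mulr_suml; apply: eq_bigr => i _; rewrite intrM mulrAC.
Qed.

Lemma affine_subspace_center p x (U : {vspace V}) :
  affine_subspace p U x -> affine_subspace p U = affine_subspace x U.
Proof.
rewrite /affine_subspace /= => xp; apply/seteqP; split=> y /= yp.
  have -> : y - x = (y - p) - (x - p) by rewrite opprB addrA subrK.
  exact: rpredB.
have -> : y - p = (y - x) + (x - p) by rewrite addrA subrK.
exact: rpredD.
Qed.

Lemma level_set_affine z x : [set y | z y = z x :> R] = affine_subspace x (lker z).
Proof.
rewrite /affine_subspace; apply/seteqP; split => y /=;
  rewrite memv_ker linearB /= subr_eq0.
  by move=> ->.
by move=> /eqP.
Qed.

(** [A] expresses the reference basis [e] in the lattice basis [b]. Along [b] the fundamental
    parallelotope is the unit cell, so both terms of the ratio in [is_rvol] are volumes for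
    [lin_vol A]. *)
Lemma is_rvol_ratio m (U : {vspace V}) (b e : m.-tuple V) (p : V) (F : set V)
    (A := \matrix_(i, j) coord b j (tnth e i)) :
  basis_of U b -> basis_of U e ->
  [/\ A \in unitmx,
      affine_lebesgue p e F = lin_vol A [set c | F (p + lin_comb (tnth b) c)] &
      affine_lebesgue p e (parallelotope p b) = lin_vol A (cell 0 1)].
Proof.
move=> bb be.
have memb i : tnth b i \in U by apply: (basis_mem bb); exact: mem_tnth.
have meme i : tnth e i \in U by apply: (basis_mem be); exact: mem_tnth.
have eA i : tnth e i = \sum_j A i j *: tnth b j.
  rewrite {1}(coord_basis bb (meme i)); apply: eq_bigr => j _.
  by rewrite mxE (tnth_nth 0 b).
pose B := \matrix_(i, j) coord e j (tnth b i).
have bB i : tnth b i = \sum_j B i j *: tnth e j.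
  rewrite {1}(coord_basis be (memb i)); apply: eq_bigr => j _.
  by rewrite mxE (tnth_nth 0 e).
have Au : A \in unitmx.
  suff /mulmx1_unit[] : A *m B = 1%:M by [].
  apply/matrixP => i j.
  have : coord e j (tnth e i) = (A *m B) i j.
    rewrite {1}eA linear_sum mxE; apply: eq_bigr => l _.
    by rewrite linearZ /= !mxE.
  by move=> <-; rewrite (tnth_nth 0 e) coord_free ?(basis_free be)// mxE eq_sym.
have coordE t : affine_coord p e t = p + lin_comb (tnth b) (lin_coord A t).
  rewrite /affine_coord /lin_comb; congr (_ + _).
  under eq_bigr do rewrite eA scaler_sumr.
  rewrite exchange_big; apply: eq_bigr => j _.
  rewrite mxE scaler_suml; apply: eq_bigr => i _.
  by rewrite scalerA [tuple_row t _ _]mxE.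
split=> //.
  rewrite /affine_lebesgue /lin_vol; congr (lebesgue_tuple R m _).
  by apply/seteqP; split => t /=; rewrite coordE.
rewrite /affine_lebesgue /lin_vol; congr (lebesgue_tuple R m _).
apply/seteqP; split => t /=; rewrite coordE.
  move=> [c c01 /addrI bc]; apply/cell0P => i; rewrite invr1.
  suff -> : lin_coord A t 0 i = c i by [].
  have := congr1 (coord b i) bc; rewrite /lin_comb.
  under eq_bigr do rewrite (tnth_nth 0 b).
  under [in X in _ = X -> _]eq_bigr do rewrite (tnth_nth 0 b).
  by rewrite !coord_sum_free ?(basis_free bb).
move=> /cell0P c01; exists (fun i => lin_coord A t 0 i) => // i.
by have := c01 i; rewrite invr1.
Qed.

End RelativeVolume.

(** * Relative volume as a limit *)

Section RelativeVolumeLimit.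
Variables (R : realType) (V : vectType R).
Variables (L P : set V) (z : 'Hom(V, R^o)) (d : nat) (e : 'I_d -> V) (w : V).
Variables (X : V -> 'rV[R]_d) (r : nat) (v : 'I_r -> V) (beta : int).
Hypothesis ad : adapted L z e w X.
Hypothesis Pv : hull_of P v.
Hypothesis Lv : forall j, L (v j).
Hypothesis zP : forall x, P x -> (z x : R) <= beta%:~R.
Hypothesis zbeta : exists j, z (v j) = beta%:~R :> R.

Let ze i : z (e i) = 0 :> R. Proof. by case: ad. Qed.
Let zw : z w = 1 :> R. Proof. by case: ad. Qed.
Let dV : \dim {:V} = d.+1. Proof. by case: ad. Qed.
Let LE x : L x <-> exists (c : 'I_d -> int) (j : int),
  x = \sum_i (c i)%:~R *: e i + j%:~R *: w.
Proof. by case: ad. Qed.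
Let linX : linear X. Proof. by case: ad => _ _ _ _ []. Qed.
Let Xc c t : X (lin_comb e c + t *: w) = c. Proof. by case: ad => _ _ _ _ []. Qed.
Let xX x : x = lin_comb e (X x) + (z x : R) *: w. Proof. by case: ad => _ _ _ _ []. Qed.

Lemma face_level : face P z = [set x | P x /\ z x = beta%:~R :> R].
Proof.
have [j0 zj0] := zbeta; apply/seteqP; split=> x /=.
  move=> [Px xmax]; split => //; apply/le_anti; rewrite zP//=.
  by rewrite -zj0; apply: xmax; exact: hull_vertex Pv j0.
by move=> [Px zx]; split => // y Py; rewrite zx; exact: zP.
Qed.

Lemma face_level_vertex : exists2 x0, L x0 & face P z x0.
Proof.
have [j0 zj0] := zbeta; exists (v j0) => //.
by rewrite face_level; split => //; exact: hull_vertex Pv j0.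
Qed.

Lemma adapted_lattice_level p (j : int) : L p -> z p = j%:~R :> R ->
  exists a : 'I_d -> int, p = j%:~R *: w + \sum_i (a i)%:~R *: e i.
Proof.
move=> /LE[c [l pE]] zp; exists c.
have : z p = l%:~R :> R.
  rewrite pE linearD linearZ /= linear_sum big1 ?add0r ?zw; first exact: mulr1.
  by move=> i _; rewrite linearZ /= ze; exact: mulr0.
by rewrite zp => ->; rewrite addrC.
Qed.

Lemma adapted_inj : injective (lin_comb e).
Proof. by move=> c c' /(congr1 (fun x => X (x + 0 *: w))); rewrite !Xc. Qed.

Lemma kernel_comb x : z x = 0 :> R -> x = lin_comb e (X x).
Proof. by move=> zx; rewrite {1}(xX x) zx scale0r addr0. Qed.

Lemma kernel_span : lker z = <<[tuple e i | i < d]>>%VS /\ \dim (lker z) = d.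
Proof.
have sub : (lker z <= <<[tuple e i | i < d]>>)%VS.
  apply/subvP => x; rewrite memv_ker => /eqP zx.
  rewrite (kernel_comb zx) /lin_comb; apply: memv_suml => i _; rewrite memvZ//.
  by rewrite -[e i](tnth_mktuple e) memv_span// mem_tnth.
have dimz : \dim (lker z) = d.
  have := limg_ker_dim z fullv; rewrite capfv dV => h.
  have : \dim (limg z) = 1%N.
    apply/eqP; rewrite eqn_leq; apply/andP; split.
      by apply: leq_trans (dimvS (subvf _)) _; rewrite dimvf /dim /=.
    rewrite lt0n dimv_eq0; apply/eqP => z0.
    have : z w \in limg z by rewrite memv_img// memvf.
    by rewrite z0 memv0 => /eqP; rewrite zw => /eqP; rewrite oner_eq0.
  by move: h => /[swap] ->; rewrite addn1 => -[].
split => //; apply/eqP; rewrite eqEdim sub dimz.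
by apply: leq_trans (dim_span _) _; rewrite size_tuple.
Qed.

Lemma affine_hull_level : affine_hull (face P z) `<=` [set x | z x = beta%:~R :> R].
Proof.
have [x0 _ Fx0] := face_level_vertex.
apply: smallest_sub; last by rewrite face_level => x [].
have zx0 : z x0 = beta%:~R :> R by move: Fx0; rewrite face_level => -[].
by exists x0, (lker z); rewrite -level_set_affine zx0.
Qed.

(** An affine hull of dimension [d] fills the level set of [z], so [U] is its kernel. Then [b] and
    [e] generate the same lattice, and the base points differ by an element of it. *)
Lemma rvol_gridset (p : V) (U : {vspace V}) (b : (\dim U).-tuple V) k :
  (0 < k)%N -> (\dim U).+1 = \dim {:V} ->
  affine_hull (face P z) = affine_subspace p U -> L p ->
  lattice_basis b [set x - p | x in affine_hull (face P z) `&` L] ->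
  gridset p (tnth b) k = gridset (beta%:~R *: w) e k.
Proof.
move=> k0 dU HE Lp [bb SE].
have Hp : affine_hull (face P z) p by rewrite HE /affine_subspace /= subrr mem0v.
have zp : z p = beta%:~R :> R by exact: affine_hull_level Hp.
have UE : U = lker z.
  apply/eqP; rewrite eqEdim; have [_ ->] := kernel_span.
  move: dU; rewrite dV => -[->]; rewrite leqnn andbT; apply/subvP => u Uu.
  have : affine_hull (face P z) (p + u) by rewrite HE /affine_subspace /= addrC addKr.
  move=> /affine_hull_level /=; rewrite linearD /= zp => /eqP.
  by rewrite -subr_eq0 addrC addKr memv_ker.
have [a pE] := adapted_lattice_level Lp zp.
have bS i : [set x - p | x in affine_hull (face P z) `&` L] (tnth b i).
  rewrite SE; apply/inIntSpanP; exists (fun j => (i == j)%:R);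
    rewrite (bigD1 i)//= eqxx scale1r.
  by rewrite big1 ?addr0// => j; rewrite eq_sym => /negPf ->; rewrite scale0r.
have bE i : exists c : 'I_d -> int, tnth b i = \sum_j (c j)%:~R *: e j.
  have [x [Hx Lx] <-] := bS i.
  have [c xE] := adapted_lattice_level Lx (affine_hull_level Hx).
  exists (fun j => c j - a j); rewrite xE pE opprD addrACA subrr add0r -sumrB.
  by apply: eq_bigr => j _; rewrite intrB scalerBl.
have spanb y : L y -> z y = 0 :> R -> exists c : 'I_(\dim U) -> int,
  y = \sum_j (c j)%:~R *: tnth b j.
  move=> Ly zy; apply/inIntSpanP.
  suff : [set x - p | x in affine_hull (face P z) `&` L] y by rewrite SE.
  exists (p + y); last by rewrite addrC addKr.
  split; first by rewrite HE /affine_subspace /= addrC addKr UE memv_ker zy.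
  move/LE: Ly => [c [l ->]]; move/LE: Lp => [c' [l' ->]]; apply/LE.
  exists (fun i => c' i + c i), (l' + l); rewrite addrACA intrD scalerDl; congr (_ + _).
  by rewrite -big_split /=; apply: eq_bigr => i _; rewrite intrD scalerDl.
have eL i : L (e i).
  apply/LE; exists (fun j => (i == j)%:R), 0;
    rewrite scale0r addr0 (bigD1 i)//= eqxx scale1r.
  by rewrite big1 ?addr0// => j; rewrite eq_sym => /negPf ->; rewrite scale0r.
have [c cE] := choice bE.
have [c' c'E] := choice (fun i => spanb _ (eL i) (ze i)).
apply/seteqP; split.
  exact: (gridset_sub (a := a) (E := c)).
apply: (gridset_sub (a := fun j => - \sum_i a i * c' i j) (E := c')) => //.
rewrite pE -addrA -[LHS]addr0; congr (_ + _).
under eq_bigr do rewrite c'E scaler_sumr.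
rewrite exchange_big -big_split /= big1// => j _.
rewrite mulrNz scaleNr rmorph_sum scaler_suml /= -sumrB big1// => i _.
by rewrite scalerA intrM subrr.
Qed.

Definition level_slice : set 'rV[R]_d := [set c | P (lin_comb e c + beta%:~R *: w)].

Lemma face_slice : [set c | face P z (beta%:~R *: w + lin_comb e c)] = level_slice.
Proof.
rewrite face_level; apply/seteqP; split=> c /=; rewrite addrC; first by case.
by move=> Pc; split => //; rewrite linear_functional_comb// zw mulr1.
Qed.

(** [lin_vol_ratio] estimates the count in the coordinates of [b], with [rv] as ratio of volumes,
    and [rvol_gridset] identifies it with the count in those of [e]. The constant comes from a
    window [M'] for the former, hence does not depend on [M]. *)
Lemma rvol_limit_full rv : is_rvol L (face P z) rv ->
  exists2 C : R, 0 <= C & forall M, level_slice `<=` window M -> forall k, (0 < k)%N ->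
    `|(gcount M k level_slice)%:R - rv * k%:R ^+ d| * k%:R <= C * k%:R ^+ d.
Proof.
move=> [p [U [b [e' [dU HE Lp [lb be ->]]]]]].
have [bb _] := lb.
have [Au -> ->] := is_rvol_ratio p (face P z) bb be.
set A := \matrix_(i, j) _ in Au *; set K := [set c | _].
have dUd : \dim U = d by move: dU; rewrite dV => -[].
have binj : injective (lin_comb (tnth b)).
  move=> c c' cc; apply/rowP => i; have := congr1 (coord b i) cc; rewrite /lin_comb.
  under eq_bigr do rewrite (tnth_nth 0 b).
  under [in X in _ = X -> _]eq_bigr do rewrite (tnth_nth 0 b).
  by rewrite !coord_sum_free ?(basis_free bb).
pose Y x : 'rV[R]_(\dim U) := \row_i coord b i x.
have linY : linear Y by move=> s x y; apply/rowP => i; rewrite !mxE linearP.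
have Yb c : Y (lin_comb (tnth b) c) = c.
  apply/rowP => i; rewrite mxE /lin_comb.
  under eq_bigr do rewrite (tnth_nth 0 b).
  by rewrite coord_sum_free ?(basis_free bb).
have Hp : affine_hull (face P z) p by rewrite HE /affine_subspace /= subrr mem0v.
have zp : z p = beta%:~R :> R by exact: affine_hull_level Hp.
have zb c : z (p + lin_comb (tnth b) c) = beta%:~R :> R.
  apply: affine_hull_level; rewrite HE /affine_subspace /= addrC addKr.
  by apply: memv_suml => i _; rewrite memvZ// (basis_mem bb)// mem_tnth.
have KE c : K c <-> P (p + lin_comb (tnth b) c).
  by rewrite /K /= face_level; split => [[]|].
have lin_combD n (f : 'I_n -> V) (c c' : 'rV[R]_n) s t :
    lin_comb f (s *: c + t *: c') = s *: lin_comb f c + t *: lin_comb f c'.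
  rewrite /lin_comb !scaler_sumr -big_split/=; apply: eq_bigr => i _.
  by rewrite !mxE scalerDl !scalerA.
have cK : is_convex K.
  move=> x y s /KE Kx /KE Ky s01; apply/KE; rewrite lin_combD.
  have := hull_convex Pv Kx Ky s01; rewrite !scalerDr addrACA -scalerDl.
  by rewrite subrKC scale1r.
have [N N0 hN] := hull_bounded Pv linY.
pose q := \sum_i `|Y p 0 i|.
have q0 : 0 <= q by apply: sumr_ge0.
pose M' := (N + (Num.truncn q).+1)%N.
have KM' : K `<=` window M'.
  move=> c /KE Kc i; have := hN _ Kc i.
  have -> : Y (p + lin_comb (tnth b) c) = Y p + c.
    by have := linY 1 p (lin_comb (tnth b) c); rewrite !scale1r Yb.
  rewrite mxE => h1; have /andP[_ h2] := truncn_itv q0.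
  have h3 : `|Y p 0 i| <= q by rewrite /q (bigD1 i)//= lerDl sumr_ge0.
  rewrite natrD; have -> : c 0 i = (Y p 0 i + c 0 i) - Y p 0 i by ring.
  by apply: le_trans (ler_normB _ _) _; lra.
have mK : lin_measurable A K.
  apply: (@lin_measurable_closed _ _ A _ _ KM') => c hc; apply/KE.
  pose Z x : 'rV[R]_(\dim {:V}) := \row_i coord (vbasis {:V}) i x.
  have linZ : linear Z by move=> s x y; apply/rowP => i; rewrite !mxE linearP.
  have injZ : injective Z.
    move=> x y /rowP xy; rewrite (coord_vbasis (memvf x)) (coord_vbasis (memvf y)).
    by apply: eq_bigr => i _; have := xy i; rewrite !mxE => ->.
  apply: (hull_closed Pv linZ injZ) => eps eps0.
  pose S := \sum_i \sum_j `|Z (tnth b j) 0 i|.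
  have S0 : 0 <= S by apply: sumr_ge0 => i _; apply: sumr_ge0.
  have SE0 : 0 <= S / eps by rewrite divr_ge0// ltW.
  (* Then [S / k.+1 <= eps]: an error [1 / k.+1] in each coordinate moves the image under [Z] by at
     most [eps]. *)
  have /andP[_ hk] := truncn_itv SE0; set k := Num.truncn _ in hk.
  have [x /KE Kx xc] := hc k.+1 (ltn0Sn k).
  exists (p + lin_comb (tnth b) x) => // i.
  have -> : Z (p + lin_comb (tnth b) x) 0 i - Z (p + lin_comb (tnth b) c) 0 i
     = \sum_j (x 0 j - c 0 j) * Z (tnth b j) 0 i.
    rewrite !mxE -linearB /= opprD addrACA subrr add0r /lin_comb -sumrB linear_sum.
    by apply: eq_bigr => j _; rewrite -scalerBl linearZ mxE.
  apply: le_trans (ler_norm_sum _ _ _) _.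
  apply: le_trans (_ : \sum_j k.+1%:R^-1 * `|Z (tnth b j) 0 i| <= _).
    by apply: ler_sum => j _; rewrite normrM ler_wpM2r.
  rewrite -mulr_sumr; apply: le_trans (_ : k.+1%:R^-1 * S <= _).
    rewrite ler_wpM2l ?invr_ge0// /S (bigD1 i)//= lerDl.
    by apply: sumr_ge0 => l _; apply: sumr_ge0.
  rewrite mulrC ler_pdivrMr ?ltr0Sn// mulrC -ler_pdivrMr//.
  exact: ltW.
set rho := _ / _.
have rho0 : 0 <= rho by rewrite divr_ge0// fine_ge0//; exact: measure_ge0.
exists ((1 + rho) * ((\dim U)%:R * ((3 * M') ^ (\dim U).-1 * 4)%N%:R)).
  by rewrite !mulr_ge0// addr_ge0.
move=> M KM k k0.
have M'0 : (0 < M')%N by rewrite /M' addnS.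
have -> : gcount M k level_slice = gcount M' k K.
  have FM : [set c | face P z (beta%:~R *: w + lin_comb e c)] `<=` window M.
    by rewrite face_slice.
  rewrite -face_slice -(card_gridset k0 adapted_inj FM) -(rvol_gridset k0 dU HE Lp lb).
  exact: card_gridset k0 binj KM'.
rewrite -dUd -[X in _ <= X]mulrA;
  apply: le_trans (_ : (1 + rho) * gcount_error R (\dim U) M' k * k%:R <= _).
  by rewrite ler_wpM2r//; exact: (lin_vol_ratio Au M'0 k0 cK mK KM').
rewrite -[X in X <= _]mulrA; apply: ler_wpM2l; first by rewrite addr_ge0.
exact: gcount_error_le.
Qed.

(** If every affine set containing the face contained the level set, then the level set would be the
    affine hull, and a lattice point of the face with the basis [e] would give a value of
    [is_rvol]. *)
Lemma not_is_rvol_level : (~ exists s, is_rvol L (face P z) s) ->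
  exists A, [/\ is_affine A, face P z `<=` A & ~ [set x | z x = beta%:~R :> R] `<=` A].
Proof.
move=> nr; apply: contrapT => nA; apply: nr.
have HE : affine_hull (face P z) = [set x | z x = beta%:~R :> R].
  apply/seteqP; split; first exact: affine_hull_level.
  move=> x zx A [afA FA]; apply: contrapT => nAx; apply: nA; exists A; split => //.
  by move/(_ x zx).
have [x0 Lx0 Fx0] := face_level_vertex.
have zx0 : z x0 = beta%:~R :> R by move: Fx0; rewrite face_level => -[].
have [kE kd] := kernel_span.
have [b bE] : exists b : (\dim (lker z)).-tuple V, forall i,
  tnth b i = e (cast_ord kd i).
  by exists [tuple e (cast_ord kd i) | i < \dim (lker z)] => i; rewrite tnth_mktuple.
have bspan y : (exists c : 'I_d -> int, y = \sum_i (c i)%:~R *: e i) <-> inIntSpan b y.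
  split=> [[c ->]|/inIntSpanP[c ->]].
    apply/inIntSpanP; exists (fun i => c (cast_ord kd i)).
    rewrite (reindex (cast_ord kd)) /=; last first.
      by apply: onW_bij; exists (cast_ord (esym kd));
        [exact: cast_ordK|exact: cast_ordKV].
    by apply: eq_bigr => i _; rewrite bE.
  exists (fun i => c (cast_ord (esym kd) i)).
  rewrite (reindex (cast_ord (esym kd))) /=; last first.
    by apply: onW_bij; exists (cast_ord kd); [exact: cast_ordKV|exact: cast_ordK].
  by apply: eq_bigr => i _; rewrite bE cast_ordKV.
have bb : basis_of (lker z) b.
  rewrite basisEdim size_tuple leqnn andbT; apply/subvP => x.
  rewrite memv_ker => /eqP zx; rewrite (kernel_comb zx); apply: memv_suml => i _.
  by rewrite memvZ// -[i](cast_ordKV kd) -bE memv_span// mem_tnth.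
pose rr := fine (affine_lebesgue x0 b (face P z)) / fine (affine_lebesgue x0 b
  (parallelotope x0 b)).
exists rr, x0, (lker z), b, b; split => //.
- by rewrite kd dV.
- by rewrite HE -zx0 level_set_affine.
split=> //; split => //; rewrite HE.
have [a x0E] := adapted_lattice_level Lx0 zx0.
apply/seteqP; split=> y /=.
  move=> [x [zx Lx] <-]; apply/bspan.
  have [c ->] := adapted_lattice_level Lx zx; exists (fun i => c i - a i).
  rewrite x0E opprD addrACA subrr add0r -sumrB.
  by apply: eq_bigr => j _; rewrite intrB scalerBl.
move=> /bspan[c yE]; exists (x0 + y); last by rewrite addrC addKr.
split.
  rewrite linearD /= zx0 yE linear_sum big1 ?addr0// => i _.
  by rewrite linearZ /= ze; exact: mulr0.
apply/LE; exists (fun i => a i + c i), beta; rewrite x0E yE [RHS]addrC -addrA;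
  congr (_ + _).
by rewrite -big_split; apply: eq_bigr => i _; rewrite intrD scalerDl.
Qed.

(** The direction of [A] omits some [e i], so a grid line parallel to [e i] has at most one point of
    the face: the count loses a power of [k]. *)
Lemma gcount_affine (A : set V) M k : (0 < k)%N ->
  is_affine A -> face P z `<=` A -> ~ [set x | z x = beta%:~R :> R] `<=` A ->
  (gcount M k level_slice)%:R <= gcount_error R d M k.
Proof.
move=> k0 [p [U ->]] FA nA.
have k0' : 0 < k%:R :> R by rewrite ltr0n.
have [x0 Lx0 Fx0] := face_level_vertex.
have zx0 : z x0 = beta%:~R :> R by move: Fx0; rewrite face_level => -[].
have [i eU] : exists i, e i \notin U.
  apply: contrapT => h; apply: nA => y /= zy;
    rewrite (affine_subspace_center (FA _ Fx0)).
  rewrite /affine_subspace /= (kernel_comb (x := y - x0)); last first.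
    by rewrite linearB /= zy zx0 subrr.
  apply: memv_suml => i _; rewrite memvZ//; apply: contrapT => /negP eU.
  by apply: h; exists i.
have d0 : (0 < d)%N by rewrite (leq_trans _ (ltn_ord i)).
apply: le_trans (_ : ((2 * M * k).+1 ^ d.-1)%N%:R * 1 <= _); last first.
  rewrite /gcount_error mulr1 -[X in X <= _]mul1r ler_pM ?ler1n// ler_peMr//; lra.
apply: (card_fibers (i := i)) => o'; rewrite -[1]/(1%:R) ler_nat.
rewrite leqNgt; apply/negP => /card_gt1P[ o1 [ o2 []]].
rewrite !finset.inE => /andP[/asboolP P1 /forallP h1] /andP[/asboolP P2 /forallP h2].
move=> /eqP; apply; apply/ffunP => j.
have [->|ji] := eqVneq j i; last first.
  by move: (h1 j) (h2 j); rewrite ji => /= /eqP-> /eqP->.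
apply/val_inj/eqP => /=.
have F1 : face P z (beta%:~R *: w + lin_comb e (gridpt R o1)).
  by have := face_slice; move=> /seteqP[_ /(_ _ P1)].
have F2 : face P z (beta%:~R *: w + lin_comb e (gridpt R o2)).
  by have := face_slice; move=> /seteqP[_ /(_ _ P2)].
have := FA _ F1; rewrite (affine_subspace_center (FA _ F2)) /affine_subspace /=.
rewrite opprD addrACA subrr add0r /lin_comb -sumrB (bigD1 i)//= big1 ?addr0; last first.
  move=> l li; rewrite !mxE; move: (h1 l) (h2 l); rewrite li => /= /eqP-> /eqP->.
  by rewrite subrr.
rewrite -scalerBl; set s := (_ - _ : R) => sU.
have : s == 0.
  apply/negPn/negP => s0; move/negP: eU; apply.
  by rewrite -[e i](scalerK s0) memvZ.
rewrite /s !mxE opprD addrACA subrr addr0 subr_eq0 => /eqP /mulIf h.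
by rewrite -(eqr_nat R); apply/eqP/h; rewrite invr_eq0 gt_eqF.
Qed.

(** When [is_rvol] has no value, the default 0 of [rvol] is the limit by [gcount_affine], so one
    statement covers faces of every dimension. *)
Lemma rvol_limit M : (0 < M)%N -> level_slice `<=` window M ->
  exists2 C : R, 0 <= C & forall k, (0 < k)%N ->
    `|(gcount M k level_slice)%:R - rvol L (face P z) * k%:R ^+ d| * k%:R <= C * k%:R
      ^+ d.
Proof.
move=> M0 KM.
have [rex|nr] := pselect (exists s, is_rvol L (face P z) s).
  have : is_rvol L (face P z) (rvol L (face P z)) by exact: xgetPex.
  by move=> /rvol_limit_full[C C0 h]; exists C => // k k0; exact: h.
have -> : rvol L (face P z) = 0.
  by rewrite /rvol xgetPN// => s hs; apply: nr; exists s.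
have [A [afA FA nA]] := not_is_rvol_level nr.
exists (d%:R * ((3 * M) ^ d.-1 * 4)%N%:R); first by rewrite mulr_ge0.
move=> k k0; rewrite mul0r subr0 ger0_norm//.
apply: le_trans (gcount_error_le _ _ M0 k0); rewrite ler_wpM2r//.
exact: gcount_affine afA FA nA.
Qed.

End RelativeVolumeLimit.

(** * Slices of lattice polytopes *)

Section Slices.
Variables (R : realType) (V : vectType R) (L : set V).

Definition slice d (e : 'I_d -> V) (w : V) (P : set V) (t : R) : set 'rV[R]_d :=
  [set c | P (lin_comb e c + t *: w)].

(** Bottom faces become top faces: only the sign of the height changes. *)
Lemma adapted_opp (z : 'Hom(V, R^o)) d (e : 'I_d -> V) w X :
  adapted L z e w X -> adapted L (- z) e (- w) X.
Proof.
move=> [dV ze zw LE [linX Xc xX]]; split => //.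
- by move=> i; rewrite opp_lfunE ze; exact: oppr0.
- by rewrite opp_lfunE linearN /= zw; exact: opprK.
- move=> x; split=> [/LE[c [j ->]]|[c [j ->]]].
    by exists c, (- j); rewrite mulrNz scaleNr scalerN opprK.
  by apply/LE; exists c, (- j); rewrite mulrNz scaleNr scalerN.
- split => //; first by move=> c t; rewrite scalerN -scaleNr.
  by move=> x; rewrite opp_lfunE scalerN -scaleNr opprK.
Qed.

Variables (z : 'Hom(V, R^o)) (d : nat) (e : 'I_d -> V) (w : V) (X : V -> 'rV[R]_d).
Hypothesis ad : adapted L z e w X.
Variables (P : set V) (r : nat) (v : 'I_r -> V).
Hypothesis Pv : hull_of P v.

Lemma slice_convex t : is_convex (slice e w P t).
Proof.
move=> x y s Px Py s01; have := hull_convex Pv Px Py s01; rewrite /slice /=.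
have -> : lin_comb e (s *: x + (1 - s) *: y) = s *: lin_comb e x + (1 - s) *: lin_comb
  e y.
  rewrite /lin_comb !scaler_sumr -big_split/=; apply: eq_bigr => i _.
  by rewrite !mxE [LHS]scalerDl !scalerA.
by rewrite !scalerDr addrACA -scalerDl subrKC scale1r.
Qed.

(** The points [v j] have coordinates bounded by [M], so [simplex_raise] moves a coordinate by at
    most [M] times the variation of the weights. Leaving [g] general allows both [z] and [- z]. *)
Lemma slice_raise (h : 'I_r -> R) (j0 : 'I_r) (g : {linear V -> R^o}) M (t s : R) x :
  (forall y, P y -> forall i, `|X y 0 i| <= M%:R) ->
  (forall j, h j = g (v j)) ->
  (forall j, h j = h j0 \/ h j <= h j0 - 1) ->
  slice e w P t x -> g (lin_comb e x + t *: w) <= s <= h j0 ->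
  exists2 y, P y & g y = s /\
    forall i, `|X y 0 i - x 0 i| <= 2 * M%:R * (s - g (lin_comb e x + t *: w)).
Proof.
move=> PM hg hj /Pv[l ls xE].
have [_ _ _ _ [linX Xc _]] := ad.
have gl l' : g (comb v l') = \sum_j l' 0 j * h j.
  by rewrite linear_sum; apply: eq_bigr => j _; rewrite linearZ hg.
rewrite xE gl => /(simplex_raise hj ls)[l' l's [l'h l'l]].
exists (comb v l'); first by apply/Pv; exists l'.
split; first by rewrite gl.
move=> i; have -> : x = X (comb v l) by rewrite -xE Xc.
rewrite !(linear_comb_sum _ linX) !summxE -sumrB.
apply: le_trans (ler_norm_sum _ _ _) _.
apply: le_trans (_ : \sum_j M%:R * `|l' 0 j - l 0 j| <= _).
  apply: ler_sum => j _; rewrite !mxE -mulrBl normrM mulrC ler_wpM2r//.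
  by apply: PM; exact: hull_vertex Pv j.
rewrite -mulr_sumr [2 * _]mulrC -mulrA ler_wpM2l//.
Qed.

Variables (a : int) (n : nat) (M : nat).
Hypothesis zv_int : forall j, z (v j) \is a Num.int.
Hypothesis zmin : exists2 j0, z (v j0) = a%:~R :> R & forall j, a%:~R <= (z (v j) : R).
Hypothesis zmax : exists2 j1, z (v j1) = a%:~R + n%:R :> R &
  forall j, (z (v j) : R) <= a%:~R + n%:R.
Hypothesis PM : forall y, P y -> forall i, `|X y 0 i| <= M%:R.

(** The bound is linear up to the extreme heights, where slices may degenerate: distinct integral
    heights of the [v j] differ by at least 1, the gap that [simplex_raise] needs. *)
Lemma slice_near t s x : a%:~R <= s <= a%:~R + n%:R -> slice e w P t x ->
  exists2 u : 'rV[R]_d, (forall i,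
    `|u 0 i| <= 2 * M%:R * `|s - t|) & slice e w P s (x + u).
Proof.
move=> /andP[as_ sb] Px.
have [dV ze zw _ [linX Xc xX]] := ad.
have zx : z (lin_comb e x + t *: w) = t :> R by rewrite linear_functional_comb// zw
  mulr1.
have int_gap (p q : R) : p \is a Num.int -> q \is a Num.int -> p <= q -> p = q \/ p <=
  q - 1.
  move=> /intrP[p' ->] /intrP[q' ->]; rewrite ler_int le_eqVlt => /orP[/eqP->|];
    first by left.
  by move=> pq; right; rewrite -[1]/(1%:~R) -intrB ler_int lerBrDr -ltzD1 ltrD2r.
suff [y Py [zy hy]] : exists2 y, P y & (z y : R) = s /\
    forall i, `|X y 0 i - x 0 i| <= 2 * M%:R * `|s - t|.
  exists (X y - x); first by move=> i; have := hy i; rewrite !mxE.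
  by rewrite /slice /= subrKC -zy -xX.
have [ts|st] := leP t s.
  have [j1 zj1 le_j1] := zmax.
  have [||||y Py [gy hy]] := @slice_raise (fun j => z (v j)) j1 z M t s x PM.
  - by [].
  - by move=> j; apply: int_gap => //; rewrite zj1.
  - by [].
  - by rewrite /= zx zj1 ts.
  exists y => //; split => // i.
  by rewrite (@ger0_norm _ (s - t)) ?subr_ge0//; have := hy i; rewrite /= zx.
(* Lowering a point is raising it for [- z]. *)
have [j0 zj0 le_j0] := zmin.
have zN x' : (- z : 'Hom(V, R^o)) x' = - (z x' : R) :> R by rewrite opp_lfunE.
have [||||y Py [gy hy]] := @slice_raise (fun j =>
  - (z (v j) : R)) j0 (- z : 'Hom(V, R^o))%R M t (- s) x PM.
- by move=> j; rewrite /= zN.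
- move=> j; apply: int_gap; rewrite ?rpredN//.
  by rewrite zj0 lerN2.
- by [].
- by rewrite /= zN zx zj0 !lerN2 as_ (ltW st).
exists y => //; split.
  by move: gy; rewrite /= zN => /oppr_inj.
move=> i; rewrite (@ltr0_norm _ (s - t)) ?subr_lt0//; have := hy i; rewrite /= zN zx.
by rewrite opprB opprK [- s + t]addrC.
Qed.

(** [gcount_thicken] in both directions, with [eps = 2 M |s - t|]. The summand 1 survives as [s]
    tends to [t], so the bound is of Lipschitz type only down to steps of order [1 / k]. *)
Lemma gcount_slice_lipschitz k t s : (0 < k)%N ->
  a%:~R <= t <= a%:~R + n%:R -> a%:~R <= s <= a%:~R + n%:R ->
  `|(gcount M k (slice e w P s))%:R - (gcount M k (slice e w P t))%:R| <=
  d%:R * (((2 * M * k).+1 ^ d.-1)%N%:R * (2 * (2 * M%:R * `|s - t| * k%:R + 1))) :> R.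
Proof.
move=> k0.
have step t' s' : a%:~R <= s' <= a%:~R + n%:R ->
  (gcount M k (slice e w P t'))%:R <= (gcount M k (slice e w P s'))%:R +
  d%:R * (((2 * M * k).+1 ^ d.-1)%N%:R * (2 * (2 * M%:R * `|s' - t'| * k%:R + 1))) :> R.
  move=> s'b; apply: gcount_thicken => //.
  - exact: slice_convex.
  - by move=> x; apply: slice_near.
move=> tb sb; rewrite ler_norml.
have := step t s sb; have := step s t tb; rewrite (distrC t s).
by move: (_ * (_ * _)) => E; lra.
Qed.

End Slices.

(** * Uniform estimates for the slice profiles *)

Section BoundarySum.
Variables (R : realType) (V : vectType R) (L : set V).
Variables (z : 'Hom(V, R^o)) (d : nat) (e : 'I_d -> V) (w : V) (X : V -> 'rV[R]_d).
Hypothesis ad : adapted L z e w X.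

(* [gcount M k (slice e w P t) / k^d] is the normalized number of points of the
   refined lattice in the slice of [P] at height [t]. *)
Definition profile M k (P : set V) (t : R) : R :=
  (gcount M k (slice e w P t))%:R / k%:R ^+ d.

(** The constants are chosen before [K], [k] and [p], since the pigeonhole argument needs bounds
    uniform in the scale. The extreme heights [a] and [a + n] are attained at some [v j], hence
    integers. *)
Lemma profile_spec (P : set V) : lattice_polytope L P -> dual_lattice L z ->
  exists (a : int) (n M : nat) (C D : R),
  [/\ (0 <= C) /\ (0 <= D),
   (forall K p i, (p <= K)%N -> (i < n * 2 ^ p)%N ->
      `|dyadic_incr (profile M (2 ^ K) P) a%:~R p i| <= C / 2 ^+ p),
   (forall k, (0 < k)%N -> `|profile M k P a%:~R + profile M k P (a%:~R + n%:R)
       - (rvol L (face P z) + rvol L (face P (- z)))| <= D / k%:R) &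
   forall K p, (p <= K)%N ->
     (universal_count P [set x | exists (c : 'I_d -> int) (j : int),
        x = \sum_i ((c i)%:~R / (2 ^ K)%:R) *: e i + (j%:~R / (2 ^ p)%:R) *: w])%:R
     = (2 ^ K)%:R ^+ d * dyadic_sum (profile M (2 ^ K) P) a%:~R n p].
Proof.
move=> polP zdual.
have [r [v [r0 Lv Pv]]] := lattice_polytope_vertices polP.
have [dV ze zw LE [linX Xc xX]] := ad.
have [M M0 PM] := hull_bounded Pv linX.
pose jr : 'I_r := Ordinal r0.
pose j0 := [arg min_(j < jr) (z (v j) : R)]%O.
pose j1 := [arg max_(j > jr) (z (v j) : R)]%O.
have min0 j : (z (v j0) : R) <= z (v j) by rewrite /j0; case: arg_minP => // i _; exact.
have max1 j : (z (v j) : R) <= z (v j1) by rewrite /j1; case: arg_maxP => // i _; exact.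
have zv_int j : (z (v j) : R) \is a Num.int by exact: zdual.
have /intrP[a aE] := zv_int j0; have /intrP[b bE] := zv_int j1.
have ab : a <= b by rewrite -(ler_int R) -aE -bE.
pose n := absz (b - a).
have bn : b%:~R = a%:~R + n%:R :> R.
  by rewrite pmulrn /n gez0_abs ?subr_ge0// intrB subrKC.
have zmin : exists2 j0, z (v j0) = a%:~R :> R & forall j, a%:~R <= (z (v j) : R).
  by exists j0 => // j; rewrite -aE.
have zmax : exists2 j1, z (v j1) = a%:~R + n%:R :> R &
  forall j, (z (v j) : R) <= a%:~R + n%:R.
  by exists j1; [rewrite bE bn|move=> j; rewrite -bn -bE].
have zcomb l : z (comb v l) = \sum_j l 0 j * z (v j) :> R.
  by rewrite linear_sum; apply: eq_bigr => j _; rewrite linearZ.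
have zP x : P x -> a%:~R <= (z x : R) <= a%:~R + n%:R.
  move=> /Pv[l [l0 l1] ->]; rewrite zcomb -bn -aE -bE.
  rewrite -[X in X <= _]mul1r -[X in _ && (_ <= X)]mul1r -l1 !mulr_suml.
  by apply/andP; split; apply: ler_sum => j _; apply: ler_wpM2l.
have sliceM t : slice e w P t `<=` window M.
  by move=> c Pc i; have := PM _ Pc i; rewrite Xc.
have [D1 D10 hD1] : exists2 C : R, 0 <= C & forall k, (0 < k)%N ->
    `|(gcount M k (slice e w P (a%:~R + n%:R)))%:R - rvol L (face P z) * k%:R ^+ d| *
      k%:R
      <= C * k%:R ^+ d.
  rewrite -bn; apply: (@rvol_limit R V L P z d e w X r v b ad Pv Lv) => //.
  - by move=> x Px; rewrite bn; have /andP[] := zP x Px.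
  - by exists j1.
  - exact: sliceM.
have [D0 D00 hD0] : exists2 C : R, 0 <= C & forall k, (0 < k)%N ->
    `|(gcount M k (slice e w P a%:~R))%:R - rvol L (face P (- z)) * k%:R ^+ d| * k%:R
      <= C * k%:R ^+ d.
  have lsE : level_slice P e (- w) (- a) = slice e w P a%:~R.
    by apply/seteqP; split => c; rewrite /level_slice /slice /= mulrNz scalerN scaleNr
      opprK.
  rewrite -lsE; apply: (@rvol_limit R V L P (- z) d e (- w) X r v (- a) (adapted_opp
    ad) Pv Lv) => //.
  - by move=> x Px; rewrite opp_lfunE mulrNz lerN2; have /andP[] := zP x Px.
  - by exists j0; rewrite opp_lfunE aE mulrNz.
  - by rewrite lsE.
pose C0 : R := d%:R * ((3 * M) ^ d.-1 * 4)%N%:R.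
have C00 : 0 <= C0 by rewrite mulr_ge0.
exists a, n, M, ((2 * M%:R + 1) * C0), (D0 + D1); split.
- by rewrite mulr_ge0 ?addr_ge0// mulr_ge0.
- move=> K p i pK ip; set k := (2 ^ K)%N.
  have k0 : (0 < k)%N by rewrite expn_gt0.
  have k0' : 0 < k%:R :> R by rewrite ltr0n.
  have kd0 : 0 < k%:R ^+ d :> R by rewrite exprn_gt0.
  have p0 : 0 < 2 ^+ p :> R by rewrite exprn_gt0.
  have pt_bound q : (q <= n * 2 ^ p)%N -> a%:~R <= @dyadic_pt R a%:~R p q <= a%:~R +
    n%:R.
    move=> qn; rewrite /dyadic_pt lerDl divr_ge0 ?(ltW p0)//= lerD2l ler_pdivrMr//.
    by rewrite -natrX -natrM ler_nat.
  have diffE : `|dyadic_pt a%:~R p i.+1 - dyadic_pt a%:~R p i| = (2 ^+ p)^-1 :> R.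
    rewrite /dyadic_pt opprD addrACA subrr add0r -mulrBl -natr1 addrAC subrr add0r
      mul1r.
    by rewrite ger0_norm// invr_ge0 ltW.
  have := gcount_slice_lipschitz ad Pv zv_int zmin zmax PM k0 (pt_bound i (ltnW ip))
    (pt_bound i.+1 ip).
  have kdi : `|(k%:R ^+ d)^-1| = (k%:R ^+ d)^-1 :> R by rewrite ger0_norm// invr_ge0
    ltW.
  rewrite diffE /dyadic_incr /profile -mulrBl normrM kdi.
  rewrite ler_pdivrMr// => h; apply: le_trans h _.
  (* Here [p <= K] enters: the rounding term 1 is absorbed by [k / 2 ^ p], whence the factor
     [2 M + 1]. *)
  have kp : 1 <= k%:R / 2 ^+ p :> R.
    by rewrite ler_pdivlMr// mul1r -natrX ler_nat leq_exp2l.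
  have := @gcount_error_le R d M k M0 k0; rewrite /gcount_error -/C0.
  set B : R := (_ ^ _)%N%:R => hB.
  apply: le_trans (_ : d%:R * (B * (2 * ((2 * M%:R + 1) * (k%:R / 2 ^+ p)))) <= _).
    rewrite ler_wpM2l// ler_wpM2l// ler_wpM2l//.
    have -> : 2 * M%:R / 2 ^+ p * k%:R = 2 * M%:R * (k%:R / 2 ^+ p) :> R by ring.
    by move: (k%:R / 2 ^+ p) kp => q1 q1_ge; lra.
  have q0 : 0 <= (2 * M%:R + 1) / 2 ^+ p :> R by rewrite divr_ge0 ?(ltW p0)//
    addr_ge0// mulr_ge0.
  have := ler_wpM2l q0 hB.
  have -> : d%:R * (B * (2 * ((2 * M%:R + 1) * (k%:R / 2 ^+ p)))) =
     (2 * M%:R + 1) / 2 ^+ p * (d%:R * (B * 4) * k%:R) / 2 by field; rewrite gt_eqF.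
  have -> : (2 * M%:R + 1) * C0 / 2 ^+ p * k%:R ^+ d =
     (2 * M%:R + 1) / 2 ^+ p * (C0 * k%:R ^+ d) by ring.
  have : 0 <= (2 * M%:R + 1) / 2 ^+ p * (d%:R * (B * 4) * k%:R) by rewrite !mulr_ge0.
  lra.
- move=> k k0; have k0' : 0 < k%:R :> R by rewrite ltr0n.
  have kd0 : 0 < k%:R ^+ d :> R by rewrite exprn_gt0.
  rewrite ler_pdivlMr// -(ler_pM2r kd0); have := hD0 k k0; have := hD1 k k0;
    rewrite /profile.
  set g1 := (gcount _ _ _)%:R; set g0 := (gcount _ _ _)%:R.
  set r1 := rvol _ _; set r0' := rvol _ _ => h1 h0.
  have -> : g0 / k%:R ^+ d + g1 / k%:R ^+ d - (r1 + r0') =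
    ((g0 - r0' * k%:R ^+ d) + (g1 - r1 * k%:R ^+ d)) / k%:R ^+ d by field;
      rewrite gt_eqF.
  have kdi : `|(k%:R ^+ d)^-1| = (k%:R ^+ d)^-1 :> R by rewrite ger0_norm// invr_ge0
    ltW.
  rewrite normrM kdi [X in X * _ <= _]mulrAC divfK ?gt_eqF//.
  apply: le_trans (_ : (`|g0 - r0' * k%:R ^+ d| + `|g1 - r1 * k%:R ^+ d|) * k%:R <= _).
    by rewrite ler_pM2r// ler_normD.
  by rewrite !mulrDl lerD.
- move=> K p pK; rewrite (card_layers (M := M) (a := a) (n :=
  n) _ _ ad zP sliceM) ?expn_gt0//.
  rewrite /dyadic_sum mulr_sumr natr_sum; apply: eq_bigr => i _.
  rewrite /profile mulrCA divff ?mulr1; last by rewrite expf_neq0// pnatr_eq0 expn_eq0.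
  by rewrite /dyadic_pt natrX.
Qed.

End BoundarySum.

(** * Comparison of the two polytopes *)

Theorem theorem2 (R : realType) (V : vectType R) (L P Q : set V)
    (dimV : (1 <= \dim {:V})%N) (latL : lattice L)
    (polP : lattice_polytope L P) (polQ : lattice_polytope L Q)
    (countPQ : forall L' : set V, lattice L' -> L `<=` L' ->
       universal_count P L' = universal_count Q L')
    (z : 'Hom(V, R^o)) (primz : primitive L z) :
  rvol L (face P z) + rvol L (face P (- z)) =
  rvol L (face Q z) + rvol L (face Q (- z)).
Proof.
have [d [e [w [X ad]]]] := adapted_exists latL primz dimV.
have [zdual _ _] := primz.
have [a [n [M [C [D [[C0 D0] lipP limP sumP]]]]]] := profile_spec ad polP zdual.
have [b [m [N [C' [D' [[C'0 D'0] lipQ limQ sumQ]]]]]] := profile_spec ad polQ zdual.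
set rP := rvol L (face P z) + _; set rQ := rvol L (face Q z) + _.
(* Twice the bound of [dyadic_compare] plus twice the squared cost of passing from profiles to
   relative volumes, as combined in [h6]. *)
pose B := 4 * ((n + m)%:R * (C + C')) ^+ 2 + 2 * (D + D') ^+ 2.
suff hB K : (0 < K)%N -> K%:R * (rP - rQ) ^+ 2 <= B.
  apply/eqP; rewrite -subr_eq0; apply/negPn/negP => ne.
  have sq0 : 0 < (rP - rQ) ^+ 2 by rewrite exprn_even_gt0.
  have B0 : 0 <= B / (rP - rQ) ^+ 2.
    by rewrite divr_ge0 ?(ltW sq0)// addr_ge0// mulr_ge0// sqr_ge0.
  have /andP[_] := truncn_itv B0; rewrite ltr_pdivrMr//.
  by move=> /lt_le_trans/(_ (hB _ (ltn0Sn _))); rewrite ltxx.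
move=> K0; have K0' : 0 < K%:R :> R by rewrite ltr0n.
pose k := (2 ^ K)%N.
have k0 : (0 < k)%N by rewrite expn_gt0.
have K_le_k : K%:R <= k%:R :> R by rewrite ler_nat ltnW// ltn_expl.
pose f := profile e w M k P; pose g := profile e w N k Q.
(* The height ranges of [P] and [Q] may differ; [C + C'] is a Lipschitz constant for both
   profiles. *)
have h1 : (f a%:~R + f (a%:~R + n%:R) - (g b%:~R + g (b%:~R + m%:R))) ^+ 2 <=
    2 * ((n + m)%:R * (C + C')) ^+ 2 / K%:R.
  apply: dyadic_compare => //.
  - move=> p i pK ip; apply: le_trans (lipP K p i pK ip) _.
    by rewrite ler_pM2r ?invr_gt0 ?exprn_gt0// lerDl.
  - move=> p i pK ip; apply: le_trans (lipQ K p i pK ip) _.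
    by rewrite ler_pM2r ?invr_gt0 ?exprn_gt0// lerDr.
  - move=> p pK; have kd0 : k%:R ^+ d != 0 :> R by rewrite expf_neq0// pnatr_eq0 -lt0n.
    apply: (mulfI kd0); rewrite -sumP// -sumQ//; congr (_%:R).
    have p0 : (0 < 2 ^ p)%N by rewrite expn_gt0.
    by have [latL' LL'] := adapted_lattice k0 p0 ad; exact: countPQ.
have h2 := limP k k0; have h3 := limQ k k0.
rewrite -/f -/g -/rP -/rQ in h2 h3.
move: h1 h2 h3; set F := f _ + _; set G := g _ + _ => h1 h2 h3.
have h4 : `|(F - G) - (rP - rQ)| <= (D + D') / K%:R.
  have -> : F - G - (rP - rQ) = (F - rP) - (G - rQ) by ring.
  apply: le_trans (ler_normB _ _) _.
  apply: le_trans (lerD h2 h3) _; rewrite -mulrDl ler_wpM2l ?addr_ge0//.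
  by rewrite lef_pV2 ?posrE// (lt_le_trans K0').
have h5 : ((F - G) - (rP - rQ)) ^+ 2 <= (D + D') ^+ 2 / K%:R.
  rewrite -real_normK ?num_real//.
  apply: le_trans (_ : ((D + D') / K%:R) ^+ 2 <= _).
    by rewrite lerXn2r ?nnegrE// divr_ge0 ?addr_ge0// ltW.
  rewrite exprMn ler_wpM2l ?sqr_ge0// expr2 ler_piMr ?invr_ge0 ?(ltW K0')//.
  by rewrite invf_le1// ler1n.
have h6 : (rP - rQ) ^+ 2 <= 2 * (F - G) ^+ 2 + 2 * ((F - G) - (rP - rQ)) ^+ 2.
  by have := sqr_ge0 ((F - G) + ((F - G) - (rP - rQ))); nra.
rewrite mulrC -ler_pdivlMr//; apply: le_trans h6 _.
rewrite /B [X in _ <= X]mulrDl; apply: lerD; last by rewrite -mulrA ler_pM2l.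
apply: le_trans (ler_wpM2l _ h1) _ => //.
by rewrite !mulrA; have -> : 2 * 2 = 4 :> R by rewrite -natrM.
Qed.
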